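(* Let $N\ge 2$, let $0=x_0<x_1<\cdots<x_N=L$, $h_i=x_i-x_{i-1}$, $h_{\min}=\min_{1\le i\le N}h_i$, and let $w_i^k$ ($1\le i\le N-1$, $k\ge0$) be the interface errors generated from initial guesses $w_1^0,\dots,w_{N-1}^0$ by the Neumann--Neumann waveform relaxation (NNWR) iteration for the one-dimensional heat equation (error equations) on $(0,L)$ with subdomains $\Omega_i=(x_{i-1},x_i)$. If $\theta=1/4$ and $T>0$ is fixed, then for $k=1,2,3,\ldots$ $$\max_{1\le i\le N-1}\|w_i^k\|_{L^\infty(0,T)}\le\left(\frac{\sqrt6}{1-e^{-\frac{(2k+1)h_{\min}^2}{T}}}\right)^{2k}e^{-k^2h_{\min}^2/T}\max_{1\le i\le N-1}\|w_i^0\|_{L^\infty(0,T)}.$$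
   Context: NNWR iteration (error equations, heat equation on $(0,L)$, zero source, zero initial data, zero outer boundary data). Given bounded initial guesses $w_i^0(t)$ on the interfaces $x_i$, $1\le i\le N-1$, with $w_0^k=w_N^k=0$ for all $k$, and a relaxation parameter $\theta\in(0,1]$, for $k=1,2,\ldots$: Dirichlet step, for $i=1,\dots,N$: $$\partial_t u_i^k-\partial_{xx}u_i^k=0\text{ in }\Omega_i,\quad u_i^k(x,0)=0,\quad u_i^k(x_{i-1},t)=w_{i-1}^{k-1}(t),\quad u_i^k(x_i,t)=w_i^{k-1}(t).$$ Neumann step, for $i=1,\dots,N$: $$\partial_t\psi_i^k-\partial_{xx}\psi_i^k=0\text{ in }\Omega_i,\quad \psi_i^k(x,0)=0,$$ $$-\partial_x\psi_i^k(x_{i-1},t)=(\partial_x u_{i-1}^k-\partial_x u_i^k)(x_{i-1},t),\qquad \partial_x\psi_i^k(x_i,t)=(\partial_x u_i^k-\partial_x u_{i+1}^k)(x_i,t),$$ except that on the physical boundary the Neumann conditions are replaced by homogeneous Dirichlet conditions: $\psi_1^k(0,t)=0$ and $\psi_N^k(L,t)=0$. Update: $w_i^k(t)=w_i^{k-1}(t)-\theta\left(\psi_i^k(x_i,t)+\psi_{i+1}^k(x_i,t)\right)$, $1\le i\le N-1$. The subdomain problems are understood through the Laplace transform in time, $\hat u(x,s)=\int_0^\infty e^{-st}u(x,t)\,dt$, $\operatorname{Re}(s)>0$ (i.e. $\partial_t$ is replaced by multiplication by $s$, and $w_i^k$ is the inverse Laplace transform of the resulting $\hat w_i^k$); data given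 only on $(0,T)$ are extended by zero (the values of $w_i^k$ on $(0,T)$ depend only on the initial guesses on $(0,T)$). The exact error solution is zero, so the $w_i^k$ are the interface errors. *)

(* Defs.v *)
From HB Require Import structures.
From mathcomp Require Import all_boot all_order all_algebra.
From mathcomp Require Import all_classical all_reals all_analysis.
From mathcomp Require Export complex.

Set Implicit Arguments.
Unset Strict Implicit.
Unset Printing Implicit Defensive.

Import Order.TTheory GRing.Theory Num.Theory.
Import numFieldNormedType.Exports.

Local Open Scope classical_set_scope.
Local Open Scope ring_scope.
Local Open Scope complex_scope.

(* Limits, derivatives and integrals of functions of a real variable with
   values in R[i] are taken componentwise. *)

Definition ccvg (R : realType) (F : set_system R) (f : R -> R[i]) : Prop :=
  cvg ((fun y => complex.Re (f y)) @ F) /\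
  cvg ((fun y => complex.Im (f y)) @ F).

Definition clim (R : realType) (F : set_system R) (f : R -> R[i]) : R[i] :=
  lim ((fun y => complex.Re (f y)) @ F) +i*
  lim ((fun y => complex.Im (f y)) @ F).

Definition cderivable (R : realType) (f : R -> R[i]) (y : R) : Prop :=
  derivable (fun z => complex.Re (f z)) y 1 /\
  derivable (fun z => complex.Im (f z)) y 1.

Definition cderive (R : realType) (f : R -> R[i]) (y : R) : R[i] :=
  derive1 (fun z => complex.Re (f z)) y +i*
  derive1 (fun z => complex.Im (f z)) y.

Definition cintegral (R : realType) (D : set R) (f : R -> R[i]) : R[i] :=
  (\int[@lebesgue_measure R]_(t in D) complex.Re (f t)) +i*
  (\int[@lebesgue_measure R]_(t in D) complex.Im (f t)).

Definition cexp (R : realType) (z : R[i]) : R[i] :=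
  (expR (complex.Re z))%:C *
  (cos (complex.Im z) +i* sin (complex.Im z)).

Definition laplace (R : realType) (f : R -> R) (s : R[i]) : R[i] :=
  cintegral `]0, +oo[ (fun t => cexp (- s * t%:C) * (f t)%:C).

(* The integral defining [laplace f s] converges absolutely whenever
   0 < Re s; note that |exp (- s t)| = exp (- Re s t). *)
Definition laplace_transformable (R : realType) (f : R -> R) : Prop :=
  forall sigma : R, 0 < sigma ->
    (@lebesgue_measure R).-integrable `]0, +oo[
      (EFin \o (fun t => expR (- sigma * t) * f t)).

Definition Linfty_norm (R : realType) (D : set R) (f : R -> R) : \bar R :=
  ('N[@lebesgue_measure R]_+oo [EFin \o (f \_ D)])%E.

(* Classical solutions on ]a, b[ of the Laplace transform of
   d_t u - d_xx u = 0, u(., 0) = 0, that are C^1 up to the endpoints.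
   Only the values of v on ]a, b[ matter; boundary values are one-sided
   limits from inside the interval. *)
Record heat_hat_solution (R : realType) (a b : R) (s : R[i])
    (v : R -> R[i]) : Prop := HeatHatSolution {
  heat_hat_derivable : forall y, a < y < b ->
    cderivable v y /\ cderivable (cderive v) y ;
  heat_hat_eq : forall y, a < y < b ->
    s * v y - cderive (cderive v) y = 0 ;
  heat_hat_trace : ccvg a^'+ v /\ ccvg b^'- v ;
  heat_hat_dtrace : ccvg a^'+ (cderive v) /\ ccvg b^'- (cderive v) }.

(* NNWR iteration for the error equations on the subdomains
   ]x_(i-1), x_i[, 1 <= i <= N.  [w k i] is w_i^k as a function of time;
   [u k i s] and [psi k i s] are the Laplace transforms in time, at s, of
   u_i^k and psi_i^k as functions of the space variable (only k >= 1 and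
   1 <= i <= N are relevant).  A step leads from [w k] to [w k.+1], so that
   the latter is the inverse Laplace transform of the right-hand side of
   [nnwr_update]. *)
Record nnwr (R : realType) (N : nat) (x : nat -> R) (theta : R)
    (w : nat -> nat -> R -> R) (u psi : nat -> nat -> R[i] -> R -> R[i]) :
    Prop := NNWR {
  nnwr_guess : forall i, (1 <= i < N)%N ->
    (Linfty_norm `]0%R, +oo[ (w 0%N i) < +oo)%E ;
  nnwr_outer : forall k t, w k 0%N t = 0 /\ w k N t = 0 ;
  nnwr_transformable : forall k i, (i <= N)%N ->
    laplace_transformable (w k i) ;
  nnwr_dirichlet : forall k i s, (1 <= i <= N)%N -> 0 < complex.Re s ->
    [/\ heat_hat_solution (x i.-1) (x i) s (u k.+1 i s),
        clim (x i.-1)^'+ (u k.+1 i s) = laplace (w k i.-1) s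
      & clim (x i)^'- (u k.+1 i s) = laplace (w k i) s] ;
  nnwr_neumann : forall k i s, (1 <= i <= N)%N -> 0 < complex.Re s ->
    [/\ heat_hat_solution (x i.-1) (x i) s (psi k.+1 i s),
        (if i == 1%N then clim (x 0%N)^'+ (psi k.+1 i s) = 0
         else - clim (x i.-1)^'+ (cderive (psi k.+1 i s)) =
                clim (x i.-1)^'- (cderive (u k.+1 i.-1 s)) -
                clim (x i.-1)^'+ (cderive (u k.+1 i s)))
      & (if i == N then clim (x N)^'- (psi k.+1 i s) = 0
         else clim (x i)^'- (cderive (psi k.+1 i s)) =
                clim (x i)^'- (cderive (u k.+1 i s)) -
                clim (x i)^'+ (cderive (u k.+1 i.+1 s)))] ;
  nnwr_update : forall k i s, (1 <= i < N)%N -> 0 < complex.Re s ->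
    laplace (w k.+1 i) s = laplace (w k i) s -
      theta%:C * (clim (x i)^'- (psi k.+1 i s) +
                  clim (x i)^'+ (psi k.+1 i.+1 s)) }.

Definition h_min (R : realType) (N : nat) (x : nat -> R) : R :=
  \big[Num.min/(x 1%N - x 0%N)]_(1 <= i < N.+1) (x i - x i.-1).

(* max over 1 <= i <= N-1 of the norm of w_i in L^oo(0,T); norms being
   nonnegative, the neutral element 0 is harmless when N >= 2. *)
Definition max_Linfty (R : realType) (N : nat) (T : R) (w : nat -> R -> R) :
    \bar R :=
  \big[maxe/0%E]_(1 <= i < N) Linfty_norm `]0, T[ (w i).

(* Main.v *)
Require Import Defs.
From HB Require Import structures.
From mathcomp Require Import all_boot all_order all_algebra.
From mathcomp Require Import all_classical all_reals all_analysis.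
From mathcomp Require Import measurable_realfun ess_sup_inf ring lra.
Import Order.TTheory GRing.Theory Num.Theory.
Import numFieldNormedType.Exports.
Local Open Scope ring_scope.

(**
Only real frequencies [s > 0] are used. Solving the subdomain problems, with
[E_i = exp (- h_i sqrt s)], [S_i = E_i^2 / (1 - E_i^2)] and
[Z_i = E_i / (1 - E_i^2)] (so that [coth (h_i sqrt s) = 1 + 2 S_i] and
[1 / sinh (h_i sqrt s) = 2 Z_i]), one step of the iteration with
[theta = 1/4] is a five-point recurrence between the transforms of the
interface errors whose coefficients are sums of products of [S_i], [Z_i] and
[S_i - S_j]. Each of these factors is, up to sign, the Laplace transform of a
nonnegative kernel: [exp (- a sqrt s)] of an explicit heat kernel, [S_i] of a
series of such kernels, and [S_i - S_j] because
[p |-> \sum_n n sqrt p exp (- n^2 p)] is nonincreasing. By uniqueness of the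
Laplace transform the step is a combination of convolutions with nonnegative
kernels [K]. In the weighted norm [sup_{0 < t < T} exp (- sigma t) |f t|] such a
convolution has norm at most [\int exp (- sigma t) K t dt], the value of the
transform at [sigma], so that a step contracts by
[2 S (1 + S) (2 + E)], computed with [h_min] at [s = sigma]. The estimate
follows by taking [sqrt sigma = (k + 1/2) h_min / T] when [h_min^2 / T] is small
and [sqrt sigma = k h_min / T] otherwise.
*)

Set Implicit Arguments.
Unset Strict Implicit.
Unset Printing Implicit Defensive.

(** * Causal functions and convolution operators *)

Section laplace_operators.
Context {R : realType}.
Local Open Scope classical_set_scope.
Local Notation mu := (@lebesgue_measure R).
Implicit Types (f g K F G : R -> R) (s t T sigma A : R).

Lemma ae_mono (P Q : R -> Prop) : (\forall t \ae mu, P t) ->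
  (forall t, P t -> Q t) -> \forall t \ae mu, Q t.
Proof. by move=> + PQ; apply: filterS => //; exact: (ae_filter_ringOfSetsType mu). Qed.

Lemma ae_mono2 (P Q S : R -> Prop) : (\forall t \ae mu, P t) ->
  (\forall t \ae mu, Q t) -> (forall t, P t -> Q t -> S t) -> \forall t \ae mu, S t.
Proof.
by move=> + + PQ; apply: filterS2 => //; exact: (ae_filter_ringOfSetsType mu).
Qed.

(** Lebesgue measure is determined by its values on half-open intervals, and the reflection pulls
    []a, b]] back to [[t - b, t - a[], of the same length. *)
Lemma lebesgue_measure_subr t (A : set R) : measurable A ->
  pushforward mu ((fun x => t - x) : _ -> measurableTypeR R) A = mu A.
Proof.
have mphi : measurable_fun setT ((fun x => t - x) : _ -> measurableTypeR R).
  exact: measurable_funB.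
move=> mA; apply/esym/lebesgue_measure_unique => //= _ [[a b]] _ <-.
rewrite /pushforward.
rewrite [X in _ = mu X](_ : _ = `[t - b, t - a[%classic); last first.
  have key (c d y : R) : (c < t - y <= d) = (t - d <= y < t - c).
    by apply/idP/idP => /andP[? ?]; apply/andP; split; lra.
  by apply/seteqP; split => x /=; rewrite !in_itv/= key.
rewrite !lebesgue_measure_itv/= !lte_fin ltrD2l ltrN2.
by case: ifPn => // _; rewrite -!EFinB; congr EFin; ring.
Qed.

Lemma ge0_integral_subr t (f : R -> \bar R) : measurable_fun setT f ->
  (forall x, (0 <= f x)%E) ->
  (\int[mu]_x f (t - x)%R = \int[mu]_x f x)%E.
Proof.
move=> mf f0.
pose phi : measurableTypeR R -> measurableTypeR R := fun x => t - x.
have mphi : measurable_fun setT phi by exact: measurable_funB.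
transitivity (\int[pushforward mu phi]_x f x)%E; last first.
  by apply: eq_measure_integral => A mA _; exact: lebesgue_measure_subr.
by rewrite (ge0_integral_pushforward mphi).
Qed.

(** Translation is a composition of two reflections. *)
Lemma ge0_integral_shift t (f : R -> \bar R) : measurable_fun setT f ->
  (forall x, (0 <= f x)%E) ->
  (\int[mu]_x f (x - t)%R = \int[mu]_x f x)%E.
Proof.
move=> mf f0.
rewrite -[RHS](ge0_integral_subr 0)//.
rewrite -[RHS](ge0_integral_subr t)//; last first.
  by apply: measurableT_comp => //; exact: measurable_funB.
by apply: eq_integral => x _; congr f; ring.
Qed.

Definition lap f s : R := \int[mu]_t (expR (- s * t) * f t).

(** Integrability for every [s > 0] includes measurability and makes [lap f] meaningful at every
    positive frequency. *)
Definition causal f := (forall t, t <= 0 -> f t = 0) /\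
  (forall s, 0 < s -> mu.-integrable setT (EFin \o (fun t => expR (- s * t) * f t))).

(** The bound concerns the window []0, T[] only: causality keeps later values of [f] out of the
    estimates. *)
Definition expbounded T sigma A f :=
  \forall t \ae mu, 0 < t < T -> `|f t| <= A * expR (sigma * t).

(* [F] is the symbol of the operator; [G sigma] bounds its norm in
   [sup_{0 < t < T} exp (- sigma t) |f t|], uniformly in [T]. *)
Definition causal_op F G := forall f, causal f -> exists v, [/\ causal v,
  (forall s, 0 < s -> lap v s = F s * lap f s) &
  forall T sigma A, 0 < sigma -> 0 <= A -> expbounded T sigma A f ->
    expbounded T sigma (G sigma * A) v].

(** The transform is stated in the extended reals, so that together with [0 <= K] it contains the
    integrability of the weighted kernel. *)
Definition kernel K F := [/\ measurable_fun setT K, (forall t, 0 <= K t),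
  (forall t, t <= 0 -> K t = 0) &
  forall s, 0 < s -> (\int[mu]_t (expR (- s * t) * K t)%:E = (F s)%:E)%E].

Lemma measurable_expMl s f : measurable_fun setT f ->
  measurable_fun setT (fun t => expR (- s * t) * f t).
Proof.
move=> mf; apply: measurable_funM => //.
by apply: measurableT_comp => //; exact: measurable_funM.
Qed.

Lemma measurable_causal f : causal f -> measurable_fun setT f.
Proof.
move=> [_ /(_ 1 ltr01) /measurable_int/measurable_EFinP mf].
rewrite (_ : f = (fun t => expR (- (- 1) * t) * (expR (- 1 * t) * f t))).
  exact: measurable_expMl.
by apply/funext => t; rewrite mulrA -expRD mulN1r opprK mul1r subrr expR0 mul1r.
Qed.

Lemma causalB f g : causal f -> causal g -> causal (fun t => f t - g t).
Proof.
move=> [f0 cf] [g0 cg]; split=> [t t0|s s0]; first by rewrite f0// g0// subrr.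
have := integrableB measurableT (cf s s0) (cg s s0).
by apply: eq_integrable => // t _ /=; rewrite -EFinB mulrBr.
Qed.

Lemma causalD f g : causal f -> causal g -> causal (fun t => f t + g t).
Proof.
move=> [f0 cf] [g0 cg]; split=> [t t0|s s0]; first by rewrite f0// g0// addr0.
have := integrableD measurableT (cf s s0) (cg s s0).
by apply: eq_integrable => // t _ /=; rewrite -EFinD mulrDr.
Qed.

Lemma causalZ c f : causal f -> causal (fun t => c * f t).
Proof.
move=> [f0 cf]; split=> [t t0|s s0]; first by rewrite f0// mulr0.
have := integrableZl measurableT c (cf s s0).
by apply: eq_integrable => // t _ /=; rewrite -EFinM mulrCA.
Qed.

Lemma lapB f g s : 0 < s -> causal f -> causal g ->
  lap (fun t => f t - g t) s = lap f s - lap g s.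
Proof.
move=> s0 [_ cf] [_ cg]; rewrite /lap -RintegralB//; [|exact: cf|exact: cg].
by apply: eq_Rintegral => t _; rewrite mulrBr.
Qed.

Lemma lapD f g s : 0 < s -> causal f -> causal g ->
  lap (fun t => f t + g t) s = lap f s + lap g s.
Proof.
move=> s0 [_ cf] [_ cg]; rewrite /lap -RintegralD//; [|exact: cf|exact: cg].
by apply: eq_Rintegral => t _; rewrite mulrDr.
Qed.

Lemma lapZ c f s : 0 < s -> causal f -> lap (fun t => c * f t) s = c * lap f s.
Proof.
move=> s0 [_ cf]; rewrite /lap -RintegralZl//; last exact: cf.
by apply: eq_Rintegral => t _; rewrite mulrCA.
Qed.

Lemma causal_op_id : causal_op (fun _ => 1) (fun _ => 1).
Proof.
move=> f cf; exists f; split => // [s _|T sigma A _ _ fA]; by rewrite mul1r.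
Qed.

Lemma causal_opZ c F G : causal_op F G ->
  causal_op (fun s => c * F s) (fun s => `|c| * G s).
Proof.
move=> FG f /FG[v [cv vE vb]]; exists (fun t => c * v t); split.
- exact: causalZ.
- by move=> s s0; rewrite lapZ// vE// mulrA.
- move=> T sigma A s0 A0 /(vb _ _ _ s0 A0) /ae_mono; apply=> t h /h h'.
  by rewrite normrM -!mulrA ler_wpM2l// mulrA.
Qed.

Lemma causal_opD F1 G1 F2 G2 : causal_op F1 G1 -> causal_op F2 G2 ->
  causal_op (fun s => F1 s + F2 s) (fun s => G1 s + G2 s).
Proof.
move=> op1 op2 f cf; have [v1 [c1 l1 b1]] := op1 f cf.
have [v2 [c2 l2 b2]] := op2 f cf.
exists (fun t => v1 t + v2 t); split.
- exact: causalD.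
- by move=> s s0; rewrite lapD// l1// l2// mulrDl.
- move=> T sigma A s0 A0 fA.
  apply: (ae_mono2 (b1 _ _ _ s0 A0 fA) (b2 _ _ _ s0 A0 fA)) => t h1 h2 tT.
  by rewrite !mulrDl (le_trans (ler_normD _ _))// lerD// (h1,h2).
Qed.

Lemma causal_opM F1 G1 F2 G2 : (forall s, 0 < s -> 0 <= G2 s) ->
  causal_op F1 G1 -> causal_op F2 G2 ->
  causal_op (fun s => F1 s * F2 s) (fun s => G1 s * G2 s).
Proof.
move=> G20 op1 op2 f cf; have [v2 [c2 l2 b2]] := op2 f cf.
have [v1 [c1 l1 b1]] := op1 v2 c2.
exists v1; split => //.
- by move=> s s0; rewrite l1// l2// mulrA.
- move=> T sigma A s0 A0 fA; rewrite -mulrA.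
  by apply: b1 => //; [rewrite mulr_ge0// G20|exact: b2].
Qed.

Lemma eq_causal_op F1 G1 F2 G2 : (forall s, 0 < s -> F1 s = F2 s) ->
  (forall s, 0 < s -> G1 s = G2 s) -> causal_op F1 G1 -> causal_op F2 G2.
Proof.
move=> eF eG op f /op[v [cv lv bv]]; exists v; split => // [s s0|T sigma A s0].
  by rewrite lv// eF.
by rewrite -eG//; exact: bv.
Qed.

(** * Convolution with a nonnegative causal kernel *)

Section convolution.
Variables (K F f : R -> R).
Hypotheses (kK : kernel K F) (cf : causal f).

Let Ks s x := expR (- s * x) * K x.
Let fs s x := expR (- s * x) * f x.
(** As [exp (- s t)] splits over [t - x] and [x], this is the convolution integrand multiplied by
    the Laplace weight at [s]. *)
Let H s (z : R * R) : \bar R := (Ks s (z.1 - z.2) * fs s z.2)%:E.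

Let mK : measurable_fun setT K. Proof. by case: kK. Qed.
Let K0 t : 0 <= K t. Proof. by case: kK. Qed.
Let KN t : t <= 0 -> K t = 0. Proof. by case: kK => _ _ + _; apply. Qed.
Let intK s : 0 < s -> (\int[mu]_t (Ks s t)%:E = (F s)%:E)%E.
Proof. by case: kK => _ _ _; apply. Qed.
Let Ks0 s x : 0 <= Ks s x. Proof. by rewrite mulr_ge0// expR_ge0. Qed.
Let mKs s : measurable_fun setT (Ks s). Proof. exact: measurable_expMl. Qed.
Let mf : measurable_fun setT f. Proof. exact: measurable_causal. Qed.
Let mfs s : measurable_fun setT (fs s). Proof. exact: measurable_expMl. Qed.

Let mH s : measurable_fun setT (H s).
Proof.
apply/measurable_EFinP; apply: measurable_funM.
  by apply: measurableT_comp => //; exact: measurable_funB.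
by apply: measurableT_comp => //; exact: measurable_snd.
Qed.

Let intKl s x : 0 < s -> (\int[mu]_t (Ks s (t - x))%:E = (F s)%:E)%E.
Proof.
move=> s0; rewrite -intK//.
rewrite (@ge0_integral_shift x (EFin \o Ks s))//.
  exact/measurable_EFinP.
by move=> y; rewrite /= lee_fin.
Qed.

Let intKr s x : 0 < s -> (\int[mu]_t (Ks s (x - t))%:E = (F s)%:E)%E.
Proof.
move=> s0; rewrite -intK//.
rewrite (@ge0_integral_subr x (EFin \o Ks s))//.
  exact/measurable_EFinP.
by move=> y; rewrite /= lee_fin.
Qed.

(** Tonelli: by translation invariance the inner integral is [F s] for each [y], which leaves [F s]
    times the integral of [|fs s|]. *)
Let iH s : 0 < s -> (mu \x mu)%E.-integrable setT (H s).
Proof.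
move=> s0; apply/(integrable21ltyP mu mu); first exact: mH.
rewrite [ltLHS](_ : _ = \int[mu]_y ((F s)%:E * (`|fs s y|)%:E))%E; last first.
  apply: eq_integral => y _; rewrite -(intKl y s0) -ge0_integralZr//=.
  - by apply: eq_integral => x _; rewrite -EFinM normrM ger0_norm.
  - by apply/measurable_EFinP; apply: measurableT_comp => //; exact: measurable_funB.
  - by move=> x _; rewrite lee_fin.
rewrite ge0_integralZl//=.
- have /integrableP[_ h] := cf.2 _ s0.
  apply: lte_mul_pinfty => //.
  by rewrite -intK//; apply: integral_ge0 => x _; rewrite lee_fin.
- by apply/measurable_EFinP; apply: measurableT_comp => //; exact: mfs.
- by rewrite -intK//; apply: integral_ge0 => x _; rewrite lee_fin.
Qed.

(* The factors [exp t] and [exp (- t)] cancel; they make the integrand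
   integrable on the product, whence the measurability of [v]. *)
Let v t := expR t * \int[mu]_x (Ks 1 (t - x) * fs 1 x).

(** [v] is built with the weight at frequency 1; reweighting recovers the section integral of [H s]
    for every [s], wherever the sections are integrable, hence almost everywhere. *)
Let v_ae s : 0 < s ->
  \forall t \ae mu, (expR (- s * t) * v t)%:E = fubini_F mu (H s) t.
Proof.
move=> s0.
have h1 := @ae_integrable1 _ _ _ _ _ _ _ _ (iH ltr01).
have hs := @ae_integrable1 _ _ _ _ _ _ _ _ (iH s0).
apply: (ae_mono2 h1 hs) => t {}h1 {}hs.
rewrite /fubini_F -[RHS]fineK; last exact: integrable_fin_num.
congr EFin; rewrite -[fine _]/(\int[mu]_x _) /v mulrA -expRD -RintegralZl//.
apply: eq_Rintegral => x _; rewrite /Ks /fs.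
have e : expR (- s * t + t) * expR (- 1 * (t - x)) * expR (- 1 * x) =
    expR (- s * (t - x)) * expR (- s * x).
  by rewrite -!expRD; congr expR; ring.
transitivity (expR (- s * t + t) * expR (- 1 * (t - x)) * expR (- 1 * x) *
  (K (t - x) * f x)); first by ring.
by rewrite e; ring.
Qed.

Let mv : measurable_fun setT v.
Proof.
apply: measurable_funM => //; apply: (@measurableT_comp _ _ _ _ _ _ (@fine R)) => //.
exact: (measurable_fubini_F (iH ltr01)).
Qed.

Let vN t : t <= 0 -> v t = 0.
Proof.
move=> t0; rewrite /v /Rintegral integral0_eq ?mulr0// => x _.
case: (lerP x 0) => x0; first by rewrite /fs cf.1// !mulr0.
by rewrite /Ks KN ?mulr0 ?mul0r//; lra.
Qed.

Let iv s : 0 < s -> mu.-integrable setT (EFin \o (fun t => expR (- s * t) * v t)).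
Proof.
move=> s0.
have mev : measurable_fun setT (fun t => expR (- s * t) * v t).
  exact: measurable_expMl.
have /integrableP[mF iF] := integrable_fubini_F (iH s0).
apply/integrableP; split; first exact/measurable_EFinP.
rewrite [ltLHS](_ : _ = \int[mu]_t `|fubini_F mu (H s) t|)%E//.
apply: ae_eq_integral => //.
- by apply: measurableT_comp => //; exact/measurable_EFinP.
- exact: measurableT_comp.
- by apply: (ae_mono (v_ae s0)) => t <- _.
Qed.

Let lapv s : 0 < s -> lap v s = F s * lap f s.
Proof.
move=> s0; apply: EFin_inj.
rewrite [LHS]fineK; last exact: (integrable_fin_num _ (iv s0)).
transitivity (\int[mu]_t fubini_F mu (H s) t)%E.
  apply: ae_eq_integral => //.
  - exact: measurable_int (iv s0).
  - exact: measurable_fubini_F (iH s0).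
  - by apply: (ae_mono (v_ae s0)) => t <- _.
rewrite (Fubini (iH s0)).
rewrite [RHS]EFinM muleC.
have h : lap f s = \int[mu]_x (fs s x) by [].
rewrite h {h} -[(_)%:E]/((fine _)%:E) fineK; last first.
  by apply: integrable_fin_num => //; exact: cf.2.
rewrite -integralZr//; last exact: cf.2.
apply: eq_integral => y _.
under eq_integral do rewrite /H /= mulrC EFinM.
rewrite integralZl//; first by rewrite intKl.
apply/integrableP; split.
  by apply/measurable_EFinP; apply: measurableT_comp => //; exact: measurable_funB.
under eq_integral do rewrite /= ger0_norm//.
by rewrite intKl// ltry.
Qed.

Let bv T sigma A : 0 < sigma -> 0 <= A -> expbounded T sigma A f ->
  expbounded T sigma (F sigma * A) v.
Proof.
move=> s0 A0 fA.
have h1 := @ae_integrable1 _ _ _ _ _ _ _ _ (iH s0).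
apply: (ae_mono2 h1 (v_ae s0)) => t {}h1 h2 /andP[t0 tT].
suff : `|expR (- sigma * t) * v t| <= F sigma * A.
  rewrite normrM ger0_norm ?expR_ge0// mulNr expRN mulrC.
  by rewrite ler_pdivrMr ?expR_gt0.
rewrite -lee_fin -abse_EFin h2 /fubini_F.
have mHt : measurable_fun setT (fun y => H sigma (t, y)) by exact: measurable_int h1.

apply: (le_trans (le_abse_integral mu measurableT mHt)).
rewrite EFinM muleC -(intKr t s0) -ge0_integralZl//=; last 2 first.
- by apply/measurable_EFinP; apply: measurableT_comp => //; exact: measurable_funB.
- by move=> x _; rewrite lee_fin.
apply: ae_ge0_le_integral => //.
- exact: (measurableT_comp (@abse_measurable R setT) mHt).
- by move=> x _; rewrite mule_ge0// lee_fin.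
- apply/measurable_EFinP; apply: measurable_funM => //.
  by apply: measurableT_comp => //; exact: measurable_funB.
apply: (ae_mono fA) => x {}fA _.
rewrite /H /= -EFinM lee_fin normrM ger0_norm//.
(* Off [0 < x < t] one of the two factors vanishes, so the bound on [f] is used only inside []0,
   T[]. *)
case: (lerP x 0) => x0.
  by rewrite /fs cf.1// mulr0 normr0 mulr0 mulr_ge0.
case: (lerP t x) => tx.
  by rewrite /Ks KN ?mulr0 ?mul0r ?mulr0//; lra.
rewrite mulrC ler_wpM2r// /fs normrM ger0_norm ?expR_ge0// mulNr expRN mulrC.
by rewrite ler_pdivrMr ?expR_gt0// fA// x0 (lt_trans tx).
Qed.

Lemma causal_op_kernel_aux : exists v, [/\ causal v,
  (forall s, 0 < s -> lap v s = F s * lap f s) &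
  forall T sigma A, 0 < sigma -> 0 <= A -> expbounded T sigma A f ->
    expbounded T sigma (F sigma * A) v].
Proof. by exists v; split. Qed.

End convolution.

Lemma causal_op_kernel K F : kernel K F -> causal_op F F.
Proof. by move=> kK f cf; exact: causal_op_kernel_aux kK cf. Qed.

End laplace_operators.

(** * Uniqueness of the Laplace transform *)

Section lerch.
Context {R : realType}.
Local Open Scope classical_set_scope.
Local Notation mu := (@lebesgue_measure R).
Variable f : R -> R.
Hypotheses (cf : causal f) (lapf0 : forall s, 0 < s -> lap f s = 0).

Let rho t := expR (- 1 * t) * f t.

Let irho : mu.-integrable setT (EFin \o rho). Proof. exact: cf.2. Qed.

Let mrho : measurable_fun setT rho.
Proof. by apply/measurable_EFinP; exact: measurable_int irho. Qed.

Let integral_rho_exp (a : R) : 0 <= a ->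
  mu.-integrable setT (fun t => (rho t * expR (- a * t))%:E) /\
  (\int[mu]_t (rho t * expR (- a * t))%:E = 0)%E.
Proof.
move=> a0; have s0 : 0 < 1 + a by rewrite ltr_wpDr.
have e : (fun t => (rho t * expR (- a * t))%:E) =
    EFin \o (fun t => expR (- (1 + a) * t) * f t).
  apply/funext => t /=; congr EFin; rewrite /rho mulrAC -expRD.
  by congr (expR _ * _); ring.
rewrite e; split; first exact: cf.2.
by rewrite -[LHS]fineK ?integrable_fin_num//; [rewrite -[fine _]/(lap f (1 + a)) lapf0|exact: cf.2].
Qed.

(* [exp (- exp (- n (t - c)))] tends to the indicator of [t > c] and expands into
   a series of exponentials [exp (- n j t)], against which [rho] integrates to 0. *)
Let psum (n : nat) (c : R) (J : nat) t :=
  series (exp_coeff (- expR (- n%:R * (t - c)))) J.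

(** Absolute values turn the partial sum into one of [exp x] with [x = exp (n c)], since
    [exp (- n (t - c)) <= exp (n c)] for [t > 0]. The bound is free of [J], as dominated convergence
    requires. *)
Let psum_le n c J t : 0 < t -> `|psum n c J t| <= expR (expR (n%:R * c)).
Proof.
move=> t0; set x := expR (n%:R * c).
apply: (@le_trans _ _ (series (exp_coeff x) J)); last first.
  apply: nondecreasing_cvgn_le; last exact: is_cvg_series_exp_coeff.
  apply: nondecreasing_series => k _ _.
  by rewrite exp_coeff_ge0// expR_ge0.
rewrite /psum /series/=; apply: (le_trans (ler_norm_sum _ _ _)).
apply: ler_sum => k _; rewrite /exp_coeff/= normrM normrX normrN.
rewrite !ger0_norm ?invr_ge0 ?expR_ge0//.
rewrite ler_wpM2r ?invr_ge0// lerXn2r ?nnegrE ?expR_ge0//.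
rewrite ler_expR; have : 0 <= n%:R * t by rewrite mulr_ge0// ltW.
lra.
Qed.

Let psum_integral n c J : mu.-integrable setT (fun t => (rho t * psum n c J t)%:E) /\
  (\int[mu]_t (rho t * psum n c J t)%:E = 0)%E.
Proof.
pose h k t : \bar R := (((-1) ^+ k * expR (n%:R * c) ^+ k / k`!%:R)%:E *
  (rho t * expR (- (n * k)%:R * t))%:E)%E.
have e : (fun t => (rho t * psum n c J t)%:E) = (fun t => \sum_(k < J) h k t)%E.
  apply/funext => t; rewrite sumEFin /psum /series/= big_mkord mulr_sumr.
  congr EFin; apply: eq_bigr => k _; rewrite /exp_coeff/=.
  have e : expR (- n%:R * (t - c)) ^+ k =
      expR (n%:R * c) ^+ k * expR (- (n * k)%:R * t).
    by rewrite -!expRM_natl -expRD natrM; congr expR; ring.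
  by rewrite [in LHS]exprNn e; ring.
have ih k : mu.-integrable setT (h k).
  by apply: integrableZl => //; exact: (integral_rho_exp _).1.
rewrite e; split; first exact: integrable_sum.
rewrite integral_sum// big1// => k _.
rewrite /h integralZl//; first by rewrite (integral_rho_exp _).2// mule0.
exact: (integral_rho_exp _).1.
Qed.

Let rhoN t : t <= 0 -> rho t = 0.
Proof. by move=> t0; rewrite /rho cf.1// mulr0. Qed.

Let integral_gumbel (n : nat) (c : R) :
  (\int[mu]_t (rho t * expR (- expR (- n%:R * (t - c))))%:E = 0)%E.
Proof.
pose B := expR (expR (n%:R * c)).
have [|||||_ _] := @dominated_convergence _ _ _ mu setT measurableT
  (fun J t => (rho t * psum n c J t)%:E)
  (fun t => (rho t * expR (- expR (- n%:R * (t - c))))%:E)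
  (fun t => (`|(rho t)%:E| * B%:E)%E).
- by move=> J; exact: measurable_int (psum_integral n c J).1.
- apply/measurable_EFinP; apply: measurable_funM => //.
  apply: measurableT_comp => //; apply: measurableT_comp => //.
  apply: measurableT_comp => //; apply: measurable_funM => //.
  exact: measurable_funB.
- apply/nearW => t _; apply: cvg_EFin; first exact: nearW.
  apply: cvgMr => //; exact: is_cvg_series_exp_coeff.
- by apply: integrableZr => //; exact: integrable_abse.
- apply/nearW => t J _; rewrite abse_EFin -EFinM lee_fin normrM.
  have [t0|t0] := lerP t 0; first by rewrite rhoN// normr0 !mul0r.
  by rewrite ler_wpM2l// psum_le.
move=> h; apply/esym; move: h; under eq_fun do rewrite (psum_integral _ _ _).2.
by move=> /cvg_lim <-//; rewrite lim_cst.
Qed.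

(** The point [t = c] is excluded: there the sequence is constantly [exp (- 1)]. *)
Let gumbel_cvg (c t : R) : t != c ->
  expR (- expR (- n%:R * (t - c))) @[n --> \oo] --> ((c < t)%R%:R : R).
Proof.
have geo (d : R) : 0 < d -> expR (- (n%:R * d)) @[n --> \oo] --> (0 : R).
  move=> d0; rewrite (_ : (fun n => _) = (fun n => expR (- d) ^+ n)); last first.
    by apply/funext => n; rewrite -expRM_natl mulrN.
  apply: cvg_expr; rewrite ger0_norm ?expR_ge0// expR_lt1 oppr_lt0.
  exact: d0.
case: (ltgtP t c) => [ct _|ct _|//].
- apply: (@squeeze_cvgr _ _ _ _ (fun _ => 0) (fun n => expR (- (n%:R * (c - t))))).
  + apply: nearW => n; rewrite expR_ge0/= ler_expR lerN2 mulNr -mulrN opprB.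
    by rewrite (le_trans _ (expR_ge1Dx _))// lerDr.
  + exact: cvg_cst.
  + by apply: geo; rewrite subr_gt0.
- rewrite [X in _ --> X](_ : _ = expR (- 0)); last by rewrite oppr0 expR0.
  apply: continuous_cvg; first exact: continuous_expR.
  apply: cvgN; under eq_fun do rewrite mulNr.
  by apply: geo; rewrite subr_gt0.
Qed.

(** Second passage to the limit, now in [n]: the double exponentials are at most 1, so [|rho|]
    dominates, and the single point [c] is negligible. *)
Let integral_tail c : mu.-integrable setT (fun t => (rho t * (c < t)%R%:R)%:E) /\
  (\int[mu]_t (rho t * (c < t)%R%:R)%:E = 0)%E.
Proof.
have [|||||i _] := @dominated_convergence _ _ _ mu setT measurableT
  (fun n t => (rho t * expR (- expR (- n%:R * (t - c))))%:E)
  (fun t => (rho t * (c < t)%R%:R)%:E)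
  (fun t => (`|(rho t)%:E|)%E).
- move=> n; apply/measurable_EFinP; apply: measurable_funM => //.
  apply: measurableT_comp => //; apply: measurableT_comp => //.
  apply: measurableT_comp => //; apply: measurable_funM => //.
  exact: measurable_funB.
- apply/measurable_EFinP; apply: measurable_funM => //.
  have -> : (fun t => (c < t)%R%:R) = \1_(`]c, +oo[%classic) :> (R -> R).
    by apply/funext => t; rewrite indicE; congr (_%:R); rewrite mem_setE in_itv/= andbT.
  exact: measurable_indic.
- exists [set c]; split; [exact: measurable_set1|exact: lebesgue_measure_set1|].
  move=> t /=; apply: contra_notP => /eqP tc _.
  apply: cvg_EFin; first exact: nearW.
  by apply: cvgMr; exact: gumbel_cvg.
- exact: integrable_abse.
- apply/nearW => t n _; rewrite abse_EFin lee_fin normrM.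
  by rewrite ler_piMr// ger0_norm ?expR_ge0// expR_le1 oppr_le0 expR_ge0.
move=> h; split => //; apply/esym; move: h; under eq_fun do rewrite integral_gumbel.
by move=> /cvg_lim <-//; rewrite lim_cst.
Qed.

(** All tails of [rho] integrate to zero, hence so does [rho] over each []-oo, x]]. Lebesgue
    differentiation gives [rho = 0] almost everywhere, and [rho] is [f] times a positive factor. *)
Lemma lerch : \forall t \ae mu, f t = 0.
Proof.
have F0 x : \int[mu]_(t in `]-oo, x]) rho t = 0.
  rewrite Rintegral_mkcond.
  rewrite (_ : _ \_ _ = fun t => rho t - rho t * (x < t)%R%:R); last first.
    apply/funext => t; rewrite patchE mem_setE in_itv/=.
    by case: (lerP t x) => _; rewrite ?mulr0 ?mulr1 ?subr0 ?subrr.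
  rewrite RintegralB//; last exact: (integral_tail x).1.
  by rewrite -[X in X - _]/(lap f 1) lapf0// /Rintegral (integral_tail x).2 subrr.
have iy y : mu.-integrable `]-oo, y] (EFin \o rho).
  by apply: integrableS irho.
have li : locally_integrable setT rho.
  by apply: open_integrable_locally => //; exact: openT.
apply: (ae_mono (FTC1Ny iy li)) => t [_].
rewrite (_ : (fun x => _) = cst 0); last by apply/funext.
rewrite derive1_cst => /esym/eqP; rewrite /rho mulf_eq0 expR_eq0/=.
by move/eqP.
Qed.

End lerch.

(** * The heat kernel *)

Section gauss_primitive.
Context {R : realType}.
Local Open Scope classical_set_scope.
Local Notation mu := (@lebesgue_measure R).

Lemma is_derive_mull (c x df : R) (f : R -> R) : is_derive x (1 : R) f df ->
  is_derive x (1 : R) (fun y => c * f y) (c * df).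
Proof. by move=> h; exact: (is_deriveZ c). Qed.

Definition gprim (x : R) : R := \int[mu]_(t in `]-oo, x]) gauss_fun t.

Lemma is_derive_gprim (x : R) : is_derive x (1 : R) gprim (gauss_fun x).
Proof.
have [||||d e] := @continuous_FTC1 R gauss_fun -oo%O x (x + 1).
- by rewrite ltrDl.
- by apply: integrableS integrableT_gauss.
- by rewrite ltNyr.
- exact: continuous_gauss_fun.
by apply: DeriveDef => //; rewrite -derive1E.
Qed.

Lemma continuous_gprim : continuous gprim.
Proof.
move=> x; apply: differentiable_continuous; apply/derivable1_diffP.
by have [] := is_derive_gprim x.
Qed.

Lemma gprim_lt x y : x < y -> gprim x < gprim y.
Proof.
move=> xy; have [|c _] := MVT xy (fun z _ => is_derive_gprim z).
  by apply: continuous_subspaceT; exact: continuous_gprim.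
by move/eqP; rewrite subr_eq => /eqP ->; rewrite ltrDr mulr_gt0 ?expR_gt0 ?subr_gt0.
Qed.

Lemma gprim_le x y : x <= y -> gprim x <= gprim y.
Proof. by rewrite le_eqVlt => /predU1P[->//|/gprim_lt/ltW]. Qed.

Lemma gprim_bounded x : 0 <= gprim x <= Num.sqrt pi.
Proof.
apply/andP; split.
  by apply: Rintegral_ge0 => t _; exact: gauss_fun_ge0.
have fin (D : set R) : measurable D ->
    (\int[mu]_(t in D) (gauss_fun t)%:E)%E \is a fin_num.
  by move=> mD; apply: integrable_fin_num => //; exact: integrableS integrableT_gauss.
rewrite -lee_fin fineK ?fin// -integralT_gauss.
apply: ge0_subset_integral => //.
  by apply/measurable_EFinP; exact: measurable_gauss_fun.
by move=> t _; rewrite lee_fin gauss_fun_ge0.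
Qed.

(** [gprimy] and [gprimNy] are the limits of [gprim] at both ends, as extrema of a bounded monotone
    function. Normalizing the heat kernel by their difference makes its transform exactly
    [exp (- a sqrt s)]. *)
Definition gprimy : R := sup (range gprim).
Definition gprimNy : R := - sup (range (fun x => - gprim (- x))).

Lemma cvg_gprimy : gprim x @[x --> +oo] --> gprimy.
Proof.
apply: nondecreasing_cvgr; first exact: gprim_le.
by exists (Num.sqrt pi) => _ [x _ <-]; case/andP: (gprim_bounded x).
Qed.

Lemma cvg_gprimNy : gprim x @[x --> -oo] --> gprimNy.
Proof.
apply/cvgNy_compNP; rewrite (_ : _ \o _ = fun x => - (- gprim (- x))); last first.
  by apply/funext => x /=; rewrite opprK.
apply: cvgN; apply: nondecreasing_cvgr.
  by move=> x y xy; rewrite lerN2 gprim_le// lerN2.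
by exists 0 => _ [x _ <-]; rewrite oppr_le0; case/andP: (gprim_bounded (- x)).
Qed.

Lemma gprim_gap : 0 < gprimy - gprimNy.
Proof.
rewrite subr_gt0.
apply: (@le_lt_trans _ _ (gprim 0)); last apply: (lt_le_trans (gprim_lt ltr01)).
  apply: (cvgr_to_le cvg_gprimNy).
  by near=> x; apply: gprim_le; near: x; exact: nbhs_ninfty_le.
apply: (cvgr_to_ge cvg_gprimy).
by near=> x; apply: gprim_le; near: x; exact: nbhs_pinfty_ge.
Unshelve. all: by end_near. Qed.

End gauss_primitive.

(** * The heat kernel and its Laplace transform *)

Section heat_kernel.
Context {R : realType}.
Local Open Scope classical_set_scope.
Local Notation mu := (@lebesgue_measure R).
Implicit Types a s t : R.

(** With [gprimy - gprimNy] standing for [sqrt pi], this is the response at distance [a] of the heat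
    equation on a half-line to a boundary impulse. *)
Definition heat_kernel a t : R := if 0 < t then
  (gprimy - gprimNy)^-1 * (a / 2 * (t * Num.sqrt t)^-1 * expR (- (a ^+ 2 / (4 * t))))
  else 0.

Let hk_fun a t : R :=
  (gprimy - gprimNy)^-1 * (a / 2 * (t * Num.sqrt t)^-1 * expR (- (a ^+ 2 / (4 * t)))).

Let continuous_hk_fun a t : 0 < t -> {for t, continuous (hk_fun a)}.
Proof.
move=> t0; apply: cvgM; first exact: cvg_cst.
apply: cvgM; first apply: cvgM; first exact: cvg_cst.
  apply: cvgV; first by rewrite mulf_neq0// gt_eqF// sqrtr_gt0.
  by apply: cvgM; [exact: cvg_id|exact: sqrt_continuous].
apply: continuous_comp; last exact: continuous_expR.
apply: cvgN; apply: cvgM; first exact: cvg_cst.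
apply: cvgV; first by rewrite mulf_neq0// gt_eqF.
by apply: cvgM; [exact: cvg_cst|exact: cvg_id].
Qed.

Lemma heat_kernel_ge0 a t : 0 <= a -> 0 <= heat_kernel a t.
Proof.
move=> a0; rewrite /heat_kernel; case: ifPn => // t0.
rewrite mulr_ge0 ?invr_ge0 ?(ltW gprim_gap)// mulr_ge0 ?expR_ge0//.
by rewrite mulr_ge0 ?divr_ge0// invr_ge0 mulr_ge0 ?sqrtr_ge0// ltW.
Qed.

Lemma measurable_heat_kernel a : measurable_fun setT (heat_kernel a).
Proof.
rewrite (_ : heat_kernel a = hk_fun a \_ `]0, +oo[%classic); last first.
  by apply/funext => t; rewrite patchE mem_setE in_itv/= andbT.
apply: (measurable_restrictT (hk_fun a) _).1 => //.
apply: open_continuous_measurable_fun; first exact: interval_open.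
move=> t.
by rewrite mem_setE in_itv/= andbT => t0; exact: continuous_hk_fun.
Qed.

Let continuous_heat_kernel a t : 0 < t -> {for t, continuous (heat_kernel a)}.
Proof.
move=> t0; change (heat_kernel a y @[y --> t] --> heat_kernel a t).
rewrite [X in _ --> X](_ : _ = hk_fun a t); last by rewrite /heat_kernel t0.
have h : hk_fun a y @[y --> t] --> hk_fun a t by exact: continuous_hk_fun.
apply: cvg_trans h; apply: near_eq_cvg; near=> y.
by rewrite /heat_kernel ifT//; near: y; exact: lt_nbhsr.
Unshelve. all: by end_near. Qed.

(** From [exp y >= y^2 / 2] at [y = a^2 / (4 t)] one gets [exp (- y) <= 32 t^2 / a^4], which
    outweighs [t^(-3/2)]. *)
Let cvg_hk0 a : 0 < a -> heat_kernel a t @[t --> 0^'+] --> (0 : R).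
Proof.
move=> a0.
pose C := (gprimy - gprimNy)^-1 * (a / 2 * (32 / (a ^+ 2) ^+ 2)) : R.
apply: (@squeeze_cvgr _ _ _ _ (fun=> 0) (fun t => C * Num.sqrt t)).
- near=> t; rewrite heat_kernel_ge0 ?(ltW a0)//=.
  have t0 : 0 < t by [].
  have st : 0 < Num.sqrt t by rewrite sqrtr_gt0.
  rewrite /heat_kernel t0 /C -[leRHS]mulrA ler_wpM2l ?invr_ge0 ?(ltW gprim_gap)//.
  rewrite -[leLHS]mulrA -[leRHS]mulrA ler_wpM2l ?divr_ge0 ?(ltW a0)//.
  rewrite invfM -mulrA ler_pdivrMl// ler_pdivrMl//.
  rewrite expRN -[leLHS]mul1r ler_pdivrMr ?expR_gt0//.
  set y := a ^+ 2 / (4 * t).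
  have y0 : 0 <= y by rewrite divr_ge0 ?sqr_ge0// mulr_ge0// ltW.
  have := @expR_ge1Dxn R y 1 y0; rewrite (_ : 2`!%:R = 2)// => h.
  have -> : Num.sqrt t * (t * (32 / a ^+ 2 ^+ 2 * Num.sqrt t)) =
      t ^+ 2 * (32 / a ^+ 2 ^+ 2).
    transitivity ((Num.sqrt t) ^+ 2 * t * (32 / a ^+ 2 ^+ 2)); first by ring.
    by rewrite sqr_sqrtr ?(ltW t0)//; ring.
  have k : t ^+ 2 * (32 / a ^+ 2 ^+ 2) * (y ^+ 2 / 2) = 1.
    by rewrite /y; field; rewrite gt_eqF//= gt_eqF.
  rewrite -[leLHS]k; apply: ler_wpM2l; last by rewrite (le_trans _ h)// lerDr.
  by rewrite mulr_ge0 ?sqr_ge0// divr_ge0// sqr_ge0.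
- exact: cvg_cst.
- rewrite -[X in _ --> X](mulr0 C) -[X in _ * X](@sqrtr0 R).
  apply: cvgM; first exact: cvg_cst.
  by apply: cvg_at_right_filter; exact: sqrt_continuous.
Unshelve. all: by end_near. Qed.

Let D : R := gprimy - gprimNy.

(* An explicit primitive in [t] of [exp (- s t) * heat_kernel a t]: with
   [al = a / (2 sqrt t)] and [be = sqrt (s t)] one has [2 al be = a sqrt s]. *)
Let heat_prim a s t : R := D^-1 *
  (expR (- a * Num.sqrt s) * (gprimy - gprim (a / 2 * (Num.sqrt t)^-1 - Num.sqrt s * Num.sqrt t)) +
   expR (a * Num.sqrt s) * (gprimy - gprim (a / 2 * (Num.sqrt t)^-1 + Num.sqrt s * Num.sqrt t))).

Let is_derive_cstB (c x df : R) (f : R -> R) : is_derive x (1 : R) f df ->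
  is_derive x (1 : R) (fun y => c - f y) (- df).
Proof.
move=> h; rewrite -[X in is_derive _ _ _ X]add0r.
exact: (is_deriveB (is_derive_cst c x 1)).
Qed.

Let is_derive_heat_prim a s t : 0 < s -> 0 < t ->
  is_derive t (1 : R) (heat_prim a s) (expR (- s * t) * heat_kernel a t).
Proof.
move=> s0 t0; have st : 0 < Num.sqrt t by rewrite sqrtr_gt0.
have ds := is_derive1_sqrt t0.
have dV : is_derive t (1 : R) (fun y => (Num.sqrt y)^-1) (- (Num.sqrt t) ^- 2 * (2 * Num.sqrt t)^-1).
  by apply: is_deriveV; rewrite gt_eqF.
have d1 : is_derive t (1 : R) (fun y => a / 2 * (Num.sqrt y)^-1 - Num.sqrt s * Num.sqrt y)
   (a / 2 * (- (Num.sqrt t) ^- 2 * (2 * Num.sqrt t)^-1) - Num.sqrt s * (2 * Num.sqrt t)^-1).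
  by apply: (is_deriveB (is_derive_mull _ dV)); exact: is_derive_mull.
have d2 : is_derive t (1 : R) (fun y => a / 2 * (Num.sqrt y)^-1 + Num.sqrt s * Num.sqrt y)
   (a / 2 * (- (Num.sqrt t) ^- 2 * (2 * Num.sqrt t)^-1) + Num.sqrt s * (2 * Num.sqrt t)^-1).
  by apply: (is_deriveD (is_derive_mull _ dV)); exact: is_derive_mull.
have g1 := is_derive1_comp (is_derive_gprim _) d1.
have g2 := is_derive1_comp (is_derive_gprim _) d2.
have h := is_derive_mull D^-1 (is_deriveD
  (is_derive_mull (expR (- a * Num.sqrt s)) (is_derive_cstB gprimy g1))
  (is_derive_mull (expR (a * Num.sqrt s)) (is_derive_cstB gprimy g2))).
refine (is_derive_eq h _).
rewrite /heat_kernel t0 /gauss_fun /D [RHS]mulrCA; congr (_ * _).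
set al := a / 2 * (Num.sqrt t)^-1; set be := Num.sqrt s * Num.sqrt t.
(* Completing the square reduces all three products of exponentials to [E]. The contributions of the
   derivative of [be] then cancel and those of [al] add up. *)
pose E := expR (- (al ^+ 2 + be ^+ 2)).
have ab : al * be * 2 = a * Num.sqrt s.
  by rewrite /al /be; field; rewrite gt_eqF.
have e1 : expR (- a * Num.sqrt s) * expR (- (al - be) ^+ 2) = E.
  by rewrite -expRD; congr expR; rewrite mulNr -ab; ring.
have e2 : expR (a * Num.sqrt s) * expR (- (al + be) ^+ 2) = E.
  by rewrite -expRD; congr expR; rewrite -ab; ring.
have e3 : expR (- s * t) * expR (- (a ^+ 2 / (4 * t))) = E.
  rewrite -expRD; congr expR; rewrite /al /be !exprMn !exprVn !sqr_sqrtr ?ltW//.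
  by field; rewrite gt_eqF.
set g1' := expR (- (al - be) ^+ 2); set g2' := expR (- (al + be) ^+ 2).
transitivity (- (expR (- a * Num.sqrt s) * g1' *
    (a / 2 * (- (Num.sqrt t) ^- 2 * (2 * Num.sqrt t)^-1) - Num.sqrt s * (2 * Num.sqrt t)^-1)) -
  expR (a * Num.sqrt s) * g2' *
    (a / 2 * (- (Num.sqrt t) ^- 2 * (2 * Num.sqrt t)^-1) + Num.sqrt s * (2 * Num.sqrt t)^-1)).
  by ring.
rewrite e1 e2 [RHS]mulrCA e3 sqr_sqrtr ?ltW//.
by field; rewrite !gt_eqF.
Qed.

Let cvg_diff0 a s : 0 < a ->
  a / 2 * (Num.sqrt t)^-1 - Num.sqrt s * Num.sqrt t @[t --> 0^'+] --> +oo.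
Proof.
move=> a0; apply/cvgryPge => A.
have sq0 : Num.sqrt t @[t --> 0^'+] --> (0 : R).
  by rewrite -[X in _ --> X](@sqrtr0 R); apply: cvg_at_right_filter; exact: sqrt_continuous.
have /cvgryPge inv : (Num.sqrt t)^-1 @[t --> (0 : R)^'+] --> +oo.
  apply/cvgrVy => //; near=> t; by rewrite sqrtr_gt0.
near=> t.
have h1 : (`|A| + Num.sqrt s) * 2 / a <= (Num.sqrt t)^-1 by near: t; exact: inv.
have h2 : Num.sqrt t <= 1.
  by rewrite -(@sqrtr1 R) ler_sqrt//; near: t; exact: nbhs_right_le.
have h3 : `|A| + Num.sqrt s <= a / 2 * (Num.sqrt t)^-1.
  rewrite (le_trans _ (ler_wpM2l _ h1)) ?divr_ge0 ?(ltW a0)//.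
  by rewrite le_eqVlt; apply/orP; left; apply/eqP; field; rewrite gt_eqF.
have h4 : Num.sqrt s * Num.sqrt t <= Num.sqrt s by rewrite ler_piMr ?sqrtr_ge0.
have := ler_norm A; lra.
Unshelve. all: by end_near. Qed.

Let cvg_sum0 a s : 0 < a ->
  a / 2 * (Num.sqrt t)^-1 + Num.sqrt s * Num.sqrt t @[t --> 0^'+] --> +oo.
Proof.
move=> a0; apply: ger_cvgy (cvg_diff0 s a0); near=> t.
have : 0 <= Num.sqrt s * Num.sqrt t by rewrite mulr_ge0 ?sqrtr_ge0.
lra.
Unshelve. all: by end_near. Qed.

Let cvg_sqrty : Num.sqrt t @[t --> (+oo : set_system R)] --> +oo.
Proof.
apply/cvgryPge => A; near=> t.
apply: (le_trans (ler_norm A)); rewrite -sqrtr_sqr; apply: ler_wsqrtr.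
by near: t; apply: nbhs_pinfty_ge; exact: num_real.
Unshelve. all: by end_near. Qed.

Let cvg_diffy a s : 0 < a -> 0 < s ->
  a / 2 * (Num.sqrt t)^-1 - Num.sqrt s * Num.sqrt t @[t --> +oo] --> -oo.
Proof.
move=> a0 s0; apply/cvgrNyPle => A; near=> t.
have h1 : 1 <= Num.sqrt t by near: t; move: cvg_sqrty => /cvgryPge; exact.
have h2 : (`|A| + a / 2) / Num.sqrt s <= Num.sqrt t.
  by near: t; move: cvg_sqrty => /cvgryPge; exact.
have ss : 0 < Num.sqrt s by rewrite sqrtr_gt0.
have h3 : a / 2 * (Num.sqrt t)^-1 <= a / 2.
  apply: ler_piMr; first by rewrite divr_ge0 ?(ltW a0).
  by rewrite invf_le1// (lt_le_trans _ h1).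
have h4 : `|A| + a / 2 <= Num.sqrt s * Num.sqrt t by rewrite [leRHS]mulrC -ler_pdivrMr.
have : - `|A| <= A by rewrite lerNl -normrN ler_norm.
lra.
Unshelve. all: by end_near. Qed.

Let cvg_sumy a s : 0 < a -> 0 < s ->
  a / 2 * (Num.sqrt t)^-1 + Num.sqrt s * Num.sqrt t @[t --> +oo] --> +oo.
Proof.
move=> a0 s0; apply/cvgryPge => A; near=> t.
have h1 : 1 <= Num.sqrt t by near: t; move: cvg_sqrty => /cvgryPge; exact.
have h2 : A / Num.sqrt s <= Num.sqrt t.
  by near: t; move: cvg_sqrty => /cvgryPge; exact.
have ss : 0 < Num.sqrt s by rewrite sqrtr_gt0.
have h3 : 0 <= a / 2 * (Num.sqrt t)^-1.
  by rewrite mulr_ge0 ?divr_ge0 ?(ltW a0)// invr_ge0 (le_trans _ h1).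
have h4 : A <= Num.sqrt s * Num.sqrt t by rewrite [leRHS]mulrC -ler_pdivrMr.
lra.
Unshelve. all: by end_near. Qed.

Let cvg_heat_prim0 a s : 0 < a -> heat_prim a s t @[t --> 0^'+] --> (0 : R).
Proof.
move=> a0; rewrite [X in _ --> X](_ : _ = D^-1 *
  (expR (- a * Num.sqrt s) * (gprimy - gprimy) +
   expR (a * Num.sqrt s) * (gprimy - gprimy))); last by rewrite subrr !mulr0 addr0 mulr0.
apply: cvgM; first exact: cvg_cst.
apply: cvgD; (apply: cvgM; first exact: cvg_cst);
  (apply: cvgB; first exact: cvg_cst).
- exact: cvg_comp (cvg_diff0 s a0) cvg_gprimy.
- exact: cvg_comp (cvg_sum0 s a0) cvg_gprimy.
Qed.

(** The argument with the minus sign runs from [+oo] down to [-oo], so the first bracket tends to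
    the full normalizing gap, while the second vanishes. *)
Let cvg_heat_primy a s : 0 < a -> 0 < s ->
  heat_prim a s t @[t --> +oo] --> expR (- a * Num.sqrt s).
Proof.
move=> a0 s0; rewrite [X in _ --> X](_ : _ = D^-1 *
  (expR (- a * Num.sqrt s) * (gprimy - gprimNy) +
   expR (a * Num.sqrt s) * (gprimy - gprimy))); last first.
  by rewrite subrr mulr0 addr0 mulrCA mulVf ?mulr1// gt_eqF// gprim_gap.
apply: cvgM; first exact: cvg_cst.
apply: cvgD; (apply: cvgM; first exact: cvg_cst);
  (apply: cvgB; first exact: cvg_cst).
- exact: cvg_comp (cvg_diffy a0 s0) cvg_gprimNy.
- exact: cvg_comp (cvg_sumy a0 s0) cvg_gprimy.
Qed.

Lemma kernel_heat_kernel a : 0 < a ->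
  kernel (heat_kernel a) (fun s => expR (- a * Num.sqrt s)).
Proof.
move=> a0; split.
- exact: measurable_heat_kernel.
- by move=> t; apply: heat_kernel_ge0; exact: ltW.
- by move=> t t0; rewrite /heat_kernel ltNge t0.
move=> s s0.
(* The value 0 at the origin is the right limit of [heat_prim], as the fundamental theorem on [[0,
   +oo[] asks. *)
pose F t := if 0 < t then heat_prim a s t else 0.
have F0 : F 0 = 0 by rewrite /F ltxx.
transitivity (\int[mu]_(t in `[0%R, +oo[) (expR (- s * t) * heat_kernel a t)%:E)%E.
  rewrite [RHS]integral_mkcond; apply: eq_integral => t _.
  rewrite patchE mem_setE in_itv/= andbT; case: (ltrP t 0) => // t0.
  by rewrite /heat_kernel ltNge (ltW t0) mulr0.
have nearF t : 0 < t -> \forall y \near t, heat_prim a s y = F y.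
  move=> t0; near=> y; have y0 : 0 < y by near: y; exact: lt_nbhsr.
  by rewrite /F y0.
have dF t : 0 < t -> is_derive t (1 : R) F (expR (- s * t) * heat_kernel a t).
  by move=> t0; apply: (near_eq_is_derive (nearF _ t0)); exact: is_derive_heat_prim.
rewrite (@ge0_continuous_FTC2y _ _ F 0 (expR (- a * Num.sqrt s))).
- by rewrite F0 sube0.
- by move=> t t0; rewrite mulr_ge0 ?expR_ge0// heat_kernel_ge0// ltW.
- apply/continuous_within_itvcyP; split.
    move=> t; rewrite in_itv/= andbT => t0; apply: cvgM.
      by apply: continuous_comp; [apply: cvgM; [exact: cvg_cst|exact: cvg_id]|exact: continuous_expR].
    exact: continuous_heat_kernel.
  rewrite {2}/heat_kernel ltxx mulr0 -[X in _ --> X](mulr0 (expR (- s * 0))).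
  apply: cvgM; last exact: cvg_hk0.
  apply: cvg_at_right_filter.
  by apply: continuous_comp; [apply: cvgM; [exact: cvg_cst|exact: cvg_id]|exact: continuous_expR].
- apply: cvg_trans (cvg_heat_primy a0 s0).
  apply: near_eq_cvg; near=> y.
  have y0 : 0 < y by near: y; exact: nbhs_pinfty_gt.
  by rewrite /F y0.
- by move=> t /dF[].
- rewrite F0; apply: cvg_trans (cvg_heat_prim0 s a0).
  by apply: near_eq_cvg; near=> y; rewrite /F ifT.
- by move=> t; rewrite in_itv/= andbT => /dF[_ <-]; rewrite derive1E.
Unshelve. all: by end_near. Qed.

End heat_kernel.

(** * Monotonicity of the kernel of coth *)

Section heat_moments.
Context {R : realType}.
Implicit Types p q : R.

Let g p (k : nat) : R := expR (- (p * k.+1%:R ^+ 2)).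

Let g_ge0 p k : 0 <= g p k. Proof. exact: expR_ge0. Qed.

(* The terms of index at least 2 are nonpositive, and the second absorbs the first. *)
Let moment_le0_large p N : 4^-1 <= p ->
  \sum_(k < N.+2) k.+1%:R * (1 - 2 * p * k.+1%:R ^+ 2) * g p k <= 0.
Proof.
move=> p4; rewrite 2!big_ord_recl addrA -[X in _ <= X]addr0 lerD//; last first.
  apply: sumr_le0 => k _; rewrite mulr_le0_ge0// mulr_ge0_le0//.
  rewrite /bump/= ?add1n subr_le0; have : (3%:R : R) <= (k.+3)%:R by rewrite ler_nat.
  move: (k.+3)%:R => m m3; nra.
rewrite /g /= /bump/= ?add1n expr1n !mulr1 mul1r.
have -> : 2%:R ^+ 2 = 4 :> R by rewrite -natrX.
set x := expR (- p).
have -> : expR (- (p * 4)) = x ^+ 4 by rewrite -expRM_natl; congr expR; ring.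
have x0 : 0 < x by exact: expR_gt0.
(* For [p >= 1/2] both terms are nonpositive. Otherwise [x >= 1/2], so
   [(1 - 2 p) x <= x^3 <= 2 x^4], whereas the coefficient of [x^4] is at most -2. *)
have [p2|p2] := lerP 2^-1 p.
  have : 0 < x ^+ 4 by rewrite exprn_gt0.
  by move: (x ^+ 4) => y y0; nra.
have x2 : 2^-1 <= x by have := expR_ge1Dx (- p); rewrite -/x; lra.
have h1 : 1 - 2 * p <= x ^+ 2.
  by rewrite -expRM_natl; have := expR_ge1Dx (2%:R * - p); lra.
have h2 : (1 - 2 * p) * x <= x ^+ 3 by rewrite exprSr ler_wpM2r// ltW.
have h3 : x ^+ 3 <= 2 * x ^+ 4.
  have : 0 < x ^+ 3 by rewrite exprn_gt0.
  by rewrite (exprSr x 3); move: (x ^+ 3) => y y0; nra.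
have h4 : 0 < x ^+ 4 by rewrite exprn_gt0.
move: (x ^+ 4) h3 h4 => y h3 h4; nra.
Qed.

(* Summation by parts, using [1 - exp (- x) <= x]. *)
Let abel p N : 0 <= p -> \sum_(k < N.+1) k.+1%:R * g p k <=
  p * (\sum_(k < N) (k.+1%:R ^+ 3 + 3 / 2 * k.+1%:R ^+ 2 + k.+1%:R / 2) * g p k)
  + N.+1%:R * (N.+1%:R + 1) / 2 * g p N.
Proof.
move=> p0; elim: N => [|N IH].
  by rewrite big_ord1 big_ord0 mulr0 add0r !mul1r (_ : (1 + 1) / 2 = 1 :> R) ?mul1r//; field.
rewrite big_ord_recr/= [in leRHS]big_ord_recr/=.
set S1 := \sum_(k < N.+1) _ in IH *; set S2 := \sum_(k < N) _ in IH *.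
(* Consecutive exponents differ by [p (2 m + 1)] with [m = N + 1]; multiplied by the triangular
   number [m (m + 1) / 2] this produces the cubic of the statement. *)
have gg : g p N * (1 - p * (2 * N.+1%:R + 1)) <= g p N.+1.
  have -> : g p N.+1 = g p N * expR (- (p * (2 * N.+1%:R + 1))).
    by rewrite /g -expRD -(natr1 N.+1); congr expR; ring.
  by rewrite ler_wpM2l//; have := expR_ge1Dx (- (p * (2 * N.+1%:R + 1))); lra.
have -> : N.+2%:R = N.+1%:R + 1 :> R by rewrite natr1.
have : 0 <= N.+1%:R :> R by [].
move: (N.+1%:R : R) gg IH => m gg IH m0.
have := ler_wpM2l (_ : 0 <= m * (m + 1) / 2) gg.
move/(_ ltac:(by rewrite divr_ge0// mulr_ge0// addr_ge0)).
lra.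
Qed.

(** After [abel], the boundary term is handled by [1 <= 2 p (N + 1)], and it remains to see that the
    sum of [n (n^2 - 3 n / 2 - 1/2) exp (- p n^2)] is nonnegative. Its coefficients start with -1,
    1, 12 and stay positive; with [x = exp (- p) >= 3/4] one has [12 x^8 >= 1], so the third term
    absorbs the first. *)
Let moment_le0_small p N : 0 < p -> p < 4^-1 -> (3 <= N)%N -> 1 <= 2 * p * N.+1%:R ->
  \sum_(k < N.+1) k.+1%:R * (1 - 2 * p * k.+1%:R ^+ 2) * g p k <= 0.
Proof.
move=> p0 p4 N3 pN.
have -> : \sum_(k < N.+1) k.+1%:R * (1 - 2 * p * k.+1%:R ^+ 2) * g p k =
    \sum_(k < N.+1) k.+1%:R * g p k - 2 * p * \sum_(k < N.+1) k.+1%:R ^+ 3 * g p k.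
  by rewrite mulr_sumr -sumrB; apply: eq_bigr => k _; ring.
rewrite subr_le0 (le_trans (abel N (ltW p0)))// big_ord_recr/= [leRHS]mulrDr lerD//.
  rewrite -mulrA mulrCA ler_pM2l// mulr_sumr -subr_ge0 -sumrB.
  rewrite (eq_bigr (fun k : 'I_N => (k.+1%:R * (k.+1%:R ^+ 2 - 3 / 2 * k.+1%:R - 2^-1)) * g p k)); last first.
    by move=> k _; ring.
  case: N N3 pN => [|[|[|N]]]// _ _.
  rewrite 3!big_ord_recl !addrA addr_ge0//; last first.
    apply: sumr_ge0 => k _; rewrite mulr_ge0//.
    rewrite /bump/= ?add1n; have : (4%:R : R) <= (k.+4)%:R by rewrite ler_nat.
    by move: (k.+4)%:R => m m3; nra.
  rewrite /g/= /bump/= ?add1n.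
  set x := expR (- p).
  have -> : expR (- (p * 1%:R ^+ 2)) = x by rewrite expr1n mulr1.
  have -> : expR (- (p * 2%:R ^+ 2)) = x ^+ 4.
    by rewrite -expRM_natl; congr expR; ring.
  have -> : expR (- (p * 3%:R ^+ 2)) = x ^+ 9.
    by rewrite -expRM_natl; congr expR; ring.
  have x34 : 3 / 4 <= x by have := expR_ge1Dx (- p); rewrite -/x; lra.
  have x0 : 0 <= x by lra.
  have x4 : 0 <= x ^+ 4 by rewrite exprn_ge0.
  rewrite (exprS x 8).
  have x2 : 11 / 20 <= x ^+ 2 by rewrite expr2; nra.
  have x4' : 3 / 10 <= x ^+ 4 by rewrite (exprM x 2 2) (expr2 (x ^+ 2)); nra.
  have x8 : 1 <= 12 * x ^+ 8 by rewrite (exprM x 4 2) (expr2 (x ^+ 4)); nra.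
  move: (x ^+ 8) (x ^+ 4) x4 x8 => y z z0 y12; nra.
rewrite mulrA ler_wpM2r//.
have N1 : (1 : R) <= N.+1%:R by rewrite ler1n.
move: (N.+1%:R : R) pN N1 => m pN N1.
have : 1 * m ^+ 2 <= 2 * p * m * m ^+ 2 by rewrite ler_wpM2r ?sqr_ge0.
nra.
Qed.

(** At [p = c^2 q] this sum is the derivative in [c] of a truncation of
    [\sum_n n c exp (- n^2 c^2 q)]. Working with partial sums avoids differentiating a series; the
    price is a lower bound on [N]. *)
Lemma heat_moment_le0 p N : 0 < p -> (4 <= N)%N -> 1 <= 2 * p * N%:R ->
  \sum_(k < N) k.+1%:R * (1 - 2 * p * k.+1%:R ^+ 2) * expR (- (p * k.+1%:R ^+ 2)) <= 0.
Proof.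
move=> p0; case: N => [|[|N]]// N4 pN.
by case: (lerP 4^-1 p) => p4; [exact: moment_le0_large|exact: moment_le0_small].
Qed.

(** Mean value theorem; the truncation condition at [a] passes to every intermediate [c > a]. *)
Lemma heat_sum_decreasing (a b q : R) N : 0 < a -> a <= b -> 0 < q ->
  (4 <= N)%N -> 1 <= 2 * (a ^+ 2 * q) * N%:R ->
  \sum_(k < N) b * k.+1%:R * expR (- (b ^+ 2 * q * k.+1%:R ^+ 2)) <=
  \sum_(k < N) a * k.+1%:R * expR (- (a ^+ 2 * q * k.+1%:R ^+ 2)).
Proof.
move=> a0; rewrite le_eqVlt => /predU1P[->//|ab] q0 N4 aN.
pose F c := \sum_(k < N) (fun x : R => x * k.+1%:R * expR (- (x ^+ 2 * q * k.+1%:R ^+ 2))) c.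
pose dF c := \sum_(k < N)
  (k.+1%:R * (1 - 2 * (c ^+ 2 * q) * k.+1%:R ^+ 2) * expR (- ((c ^+ 2 * q) * k.+1%:R ^+ 2))).
have dFE (c : R) : is_derive c (1 : R) F (dF c).
  rewrite (_ : F = \sum_(k < N) (fun x : R => x * k.+1%:R * expR (- (x ^+ 2 * q * k.+1%:R ^+ 2)))); last first.
    by apply/funext => y; rewrite fct_sumE.
  apply: is_derive_sum => k.
  have h0 := is_deriveM (is_derive_id c 1) (is_derive_id c 1).
  have h1 := is_derive1_comp (is_derive_expR _) (is_derive_mull (- (q * k.+1%:R ^+ 2)) h0).
  have h2 := is_deriveM (is_derive_mull k.+1%:R (is_derive_id c 1)) h1.
  have e : (fun x : R => x * k.+1%:R * expR (- (x ^+ 2 * q * k.+1%:R ^+ 2))) =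
      (fun x : R => (k.+1%:R * x) * expR (- (q * k.+1%:R ^+ 2) * (x * x))).
    by apply/funext => x; congr (_ * expR _); ring.
  rewrite e; refine (is_derive_eq h2 _).
  have -> : - (c ^+ 2 * q * k.+1%:R ^+ 2) = - (q * k.+1%:R ^+ 2) * (c * c) by ring.
  by rewrite /GRing.scale/=; ring.
have [|c] := MVT ab (fun c _ => dFE c).
  apply: derivable_within_continuous => c _; by have [] := dFE c.
rewrite in_itv/= => /andP[ac cb] e.
rewrite -[leLHS]/(F b) -[leRHS]/(F a) -subr_le0 e mulr_le0_ge0//; last by rewrite subr_ge0 ltW.
apply: heat_moment_le0 => //.
  by rewrite mulr_gt0// exprn_gt0// (lt_trans a0).
apply: (le_trans aN); rewrite ler_wpM2r// ler_wpM2l// ler_wpM2r ?(ltW q0)//.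
by rewrite lerXn2r ?nnegrE ?(ltW ac)// ltW// (lt_trans a0).
Qed.

End heat_moments.

(** * Series and differences of kernels *)

Section kernel_constructions.
Context {R : realType}.
Local Open Scope classical_set_scope.
Local Notation mu := (@lebesgue_measure R).

Lemma kernel_integrable (K F : R -> R) s : kernel K F -> 0 < s ->
  mu.-integrable setT (fun t => (expR (- s * t) * K t)%:E).
Proof.
move=> [mK K0 _ iK] s0; apply/integrableP; split.
  by apply/measurable_EFinP; exact: measurable_expMl.
under eq_integral do rewrite abse_EFin ger0_norm ?mulr_ge0 ?expR_ge0//.
by rewrite iK// ltry.
Qed.

Lemma kernel_diff (K F K' F' : R -> R) : kernel K F -> kernel K' F' ->
  (\forall t \ae mu, K' t <= K t) -> exists K'', kernel K'' (fun s => F s - F' s).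
Proof.
(* The comparison holds almost everywhere only; the absolute value gives a representative that is
   nonnegative everywhere. *)
move=> kK kK' le; exists (fun t => `|K t - K' t|); split.
- apply: measurableT_comp => //; apply: measurable_funB.
  + by case: kK.
  + by case: kK'.
- by move=> t.
- case: kK kK' => _ _ KN _ [_ _ KN' _] t t0; by rewrite KN// KN'// subrr normr0.
move=> s s0; have [_ _ _ iK] := kK; have [_ _ _ iK'] := kK'.
rewrite EFinB -iK// -iK'// -integralB//; last 2 first.
- exact: (kernel_integrable kK s0).
- exact: (kernel_integrable kK' s0).
apply: ae_eq_integral => //.
- apply/measurable_EFinP; apply: measurable_expMl; apply: measurableT_comp => //.
  by apply: measurable_funB; [case: kK|case: kK'].
- apply: emeasurable_funB; [exact: measurable_int (kernel_integrable kK s0)|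
                            exact: measurable_int (kernel_integrable kK' s0)].
- by apply: (ae_mono le) => t h _ /=; rewrite -EFinB -mulrBr ger0_norm// subr_ge0.
Qed.

Lemma kernel_series (K F : nat -> R -> R) (G : R -> R) :
  (forall n, kernel (K n) (F n)) ->
  (forall s, 0 < s -> \sum_(0 <= k < n) F k s @[n --> \oo] --> G s) ->
  exists K', kernel K' G /\
    \forall t \ae mu, (K' t)%:E = (\sum_(0 <= n <oo) (K n t)%:E)%E.
Proof.
move=> kK FG; pose S t := (\sum_(0 <= n <oo) (K n t)%:E)%E.
have K0 n t : 0 <= K n t by case: (kK n).
have mK n : measurable_fun setT (K n) by case: (kK n).
have mS : measurable_fun setT S.
  apply: ge0_emeasurable_sum => [n t _ _|n _]; first by rewrite lee_fin.
  exact/measurable_EFinP.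
have S0 t : (0 <= S t)%E by apply: nneseries_ge0 => n _ _; rewrite lee_fin.
have iS s : 0 < s -> (\int[mu]_t ((expR (- s * t))%:E * S t) = (G s)%:E)%E.
  move=> s0; transitivity (\int[mu]_t (\sum_(0 <= n <oo) (expR (- s * t) * K n t)%:E))%E.
    apply: eq_integral => t _; rewrite /S -nneseriesZl//.
    by move=> n _; rewrite lee_fin.
  rewrite integral_nneseries//; last 2 first.
  - by move=> n; apply/measurable_EFinP; exact: measurable_expMl.
  - by move=> n t _; rewrite lee_fin mulr_ge0// expR_ge0.
  under eq_eseriesr do rewrite (let: And4 _ _ _ h := kK _ in h)//.
  apply/cvg_lim => //.
  under eq_fun do rewrite sumEFin.
  by apply: cvg_EFin; [exact: nearW|exact: FG].
have meS (s : R) : measurable_fun setT (fun t : R => (expR (- s * t))%:E * S t)%E.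
  apply: emeasurable_funM => //; apply/measurable_EFinP.
  by apply: measurableT_comp => //; exact: measurable_funM.
(* The weighted sum has a finite integral at frequency 1, so the series converges almost everywhere;
   [fine] puts 0 at the other points. *)
have fS : \forall t \ae mu, S t \is a fin_num.
  have : mu.-integrable setT (fun t : R => (expR (- 1 * t))%:E * S t)%E.
    apply/integrableP; split; first exact: meS.
    rewrite [ltLHS](_ : _ = (G 1)%:E) ?ltry// -iS//; apply: eq_integral => t _.
    by rewrite gee0_abs ?mule_ge0 ?lee_fin ?expR_ge0.
  move=> /integrable_ae => /(_ measurableT) /ae_mono; apply => t /(_ I).
  rewrite ge0_fin_numE ?mule_ge0 ?lee_fin ?expR_ge0// => h.
  rewrite ge0_fin_numE//; move: h; case: (S t) (S0 t) => [r _ _||]//; first by rewrite ltry.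
  by rewrite gt0_muley ?lte_fin ?expR_gt0.
exists (fun t => fine (S t)); split; last first.
  by apply: (ae_mono fS) => t h; rewrite fineK.
split.
- by apply: measurableT_comp => //.
- by move=> t; exact: fine_ge0.
- move=> t t0; rewrite /S eseries0// => n _ _.
  by have [_ _ -> //] := kK n.
move=> s s0; rewrite -iS//; apply: ae_eq_integral => //.
- by apply/measurable_EFinP; apply: measurable_expMl; exact: measurableT_comp.
- exact: meS.
- by apply: (ae_mono fS) => t h _; rewrite EFinM fineK.
Qed.

(** This is [(coth (a sqrt s) - 1) / 2], the sum of [exp (- 2 a n sqrt s)] over [n >= 1]. *)
Definition geomker (a s : R) : R :=
  expR (- (2 * a) * Num.sqrt s) / (1 - expR (- (2 * a) * Num.sqrt s)).

Let hks a (n : nat) : R -> R := heat_kernel (2 * a * n.+1%:R).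

Lemma kernel_geomker a : 0 < a -> exists K, kernel K (geomker a) /\
  \forall t \ae mu, (K t)%:E = (\sum_(0 <= n <oo) (hks a n t)%:E)%E.
Proof.
move=> a0; apply: (@kernel_series _ (fun n s => expR (- (2 * a * n.+1%:R) * Num.sqrt s))).
  by move=> n; apply: kernel_heat_kernel; rewrite !mulr_gt0.
move=> s s0; set z := expR (- (2 * a) * Num.sqrt s).
rewrite [X in X @ _](_ : _ = series (geometric z z)); last first.
  apply/funext => n; rewrite /series/=; apply: eq_bigr => k _.
  by rewrite /geometric/= -exprS -expRM_natl; congr expR; ring.
apply: cvg_geometric_series; rewrite ger0_norm ?expR_ge0// expR_lt1.
by rewrite mulNr oppr_lt0 !mulr_gt0// sqrtr_gt0.
Qed.

(** The first factor is free of [a]; the second is a term of [heat_sum_decreasing] with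
    [q = 1 / t]. *)
Let hksE a n t : 0 < t -> hks a n t = ((gprimy - gprimNy)^-1 * (t * Num.sqrt t)^-1) *
  (a * n.+1%:R * expR (- (a ^+ 2 * t^-1 * n.+1%:R ^+ 2))).
Proof.
move=> t0; rewrite /hks /heat_kernel t0.
have -> : (2 * a * n.+1%:R) ^+ 2 / (4 * t) = a ^+ 2 * t^-1 * n.+1%:R ^+ 2.
  by field; rewrite gt_eqF.
have -> : 2 * a * n.+1%:R / 2 = a * n.+1%:R by field.
by ring.
Qed.

(** The two series need not be ordered term by term, but their partial sums are ordered from a rank
    depending on [t], and this passes to the limit. *)
Lemma kernel_geomker_diff a b : 0 < a -> a <= b ->
  exists K, kernel K (fun s => geomker a s - geomker b s).
Proof.
move=> a0 ab; have b0 := lt_le_trans a0 ab.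
have [Ka [kKa Ea]] := kernel_geomker a0; have [Kb [kKb Eb]] := kernel_geomker b0.
apply: (kernel_diff kKa kKb); apply: (ae_mono2 Ea Eb) => t {}Ea {}Eb.
have [t0|t0] := lerP t 0.
  by have [_ _ -> // _] := kKa; have [_ _ -> // _] := kKb.
rewrite -lee_fin Ea Eb.
have h0 c n : 0 < c -> 0 <= hks c n t.
  by move=> c0; apply: heat_kernel_ge0; rewrite !mulr_ge0// ltW.
apply: lee_lim.
- by apply: is_cvg_nneseries => n _ _; rewrite lee_fin h0.
- by apply: is_cvg_nneseries => n _ _; rewrite lee_fin h0.
near=> N; rewrite !sumEFin lee_fin !big_mkord.
under eq_bigr do rewrite hksE//.
under [leRHS]eq_bigr do rewrite hksE//.
rewrite -!mulr_sumr ler_wpM2l//.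
  by rewrite mulr_ge0// invr_ge0 ?(ltW gprim_gap)// mulr_ge0 ?sqrtr_ge0// ltW.
apply: heat_sum_decreasing => //.
- by rewrite invr_gt0.
- by near: N; exact: nbhs_infty_ge.
have p0 : 0 < 2 * (a ^+ 2 * t^-1) by rewrite !mulr_gt0// ?invr_gt0.
by rewrite -ler_pdivrMl// mulr1; near: N; exact: nbhs_infty_ger.
Unshelve. all: by end_near. Qed.

Lemma geomker_ge0 a s : 0 < a -> 0 < s -> 0 <= geomker a s.
Proof.
move=> a0 s0; rewrite divr_ge0 ?expR_ge0// subr_ge0 expR_le1.
by rewrite mulNr oppr_le0 !mulr_ge0 ?sqrtr_ge0// ltW.
Qed.

(** The kernel of the difference has a constant sign, so the norm is bounded by the absolute
    difference of the symbols rather than by their sum. This saves a factor 2 in the off-diagonal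
    coefficients. *)
Lemma causal_op_geomker_diff a b : 0 < a -> 0 < b ->
  causal_op (fun s => geomker a s - geomker b s)
    (fun s => `|geomker a s - geomker b s|).
Proof.
move=> a0 b0.
have op c d : 0 < c -> c <= d ->
    causal_op (fun s => geomker c s - geomker d s) (fun s => `|geomker c s - geomker d s|).
  move=> c0 cd; have [K kK] := kernel_geomker_diff c0 cd.
  apply: eq_causal_op (causal_op_kernel kK) => // s s0.
  rewrite ger0_norm// -lee_fin; have [_ K0 _ <-//] := kK.
  by apply: integral_ge0 => t _; rewrite lee_fin mulr_ge0 ?expR_ge0.
have [ab|/ltW ba] := lerP a b; first exact: op.
apply: eq_causal_op (causal_opZ (-1) (op _ _ b0 ba)) => s s0.
  by ring.
by rewrite normrN1 mul1r distrC.
Qed.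

End kernel_constructions.

(** * Traces of subdomain solutions *)

Section heat_hat_traces.
Context {R : realType}.
Local Open Scope classical_set_scope.

(** The hypotheses concern interior points only, so both one-sided limits are identified with the
    value at the midpoint. *)
Lemma derive0_trace_eq (f : R -> R) (a b la lb : R) : a < b ->
  (forall y, a < y < b -> is_derive y (1 : R) f 0) ->
  f y @[y --> a^'+] --> la -> f y @[y --> b^'-] --> lb -> la = lb.
Proof.
move=> ab df fa fb; pose m := (a + b) / 2.
have am : a < m by rewrite /m; lra.
have mb : m < b by rewrite /m; lra.
have cst_f y z : a < y -> y < z -> z < b -> f y = f z.
  move=> ay yz zb.
  have cf : {within `[y, z], continuous f}.
    apply: derivable_within_continuous => t; rewrite in_itv/= => /andP[yt tz].
    by have [] : is_derive t (1 : R) f 0 by apply: df; rewrite (lt_le_trans ay yt) (le_lt_trans tz zb).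
  have dfo t : t \in `]y, z[%R -> is_derive t (1 : R) f (cst 0 t).
    rewrite in_itv/= => /andP[yt tz]; apply: df.
    by rewrite (lt_trans ay yt) (lt_trans tz zb).
  have [c _] := @MVT R f (cst 0) y z yz dfo cf.
  by rewrite mul0r => /eqP; rewrite subr_eq0 => /eqP.
have ha : f y @[y --> a^'+] --> f m.
  apply: cvg_near_cst; near=> y.
  have ym : y < m by near: y; exact: nbhs_right_lt.
  by rewrite (cst_f y m).
have hb : f y @[y --> b^'-] --> f m.
  apply: cvg_near_cst; near=> y.
  have my : m < y by near: y; exact: nbhs_left_gt.
  by rewrite (cst_f m y).
have hT := @Rhausdorff R.
by rewrite -(cvg_unique hT ha fa) -(cvg_unique hT hb fb).
Unshelve. all: by end_near. Qed.

(* [(v' + r v) exp (- r y)] is constant. *)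
Lemma helmholtz_trace (v : R -> R) (a b r va vb dva dvb : R) : a < b ->
  (forall y, a < y < b -> [/\ derivable v y 1, derivable (derive1 v) y 1 &
    derive1 (derive1 v) y = r ^+ 2 * v y]) ->
  v y @[y --> a^'+] --> va -> v y @[y --> b^'-] --> vb ->
  derive1 v y @[y --> a^'+] --> dva -> derive1 v y @[y --> b^'-] --> dvb ->
  dvb + r * vb = expR (r * (b - a)) * (dva + r * va).
Proof.
move=> ab hv hva hvb hdva hdvb.
have cexp (t : R) : {for t, continuous (fun y : R => expR (- r * y))}.
  apply: continuous_comp; last exact: continuous_expR.
  by apply: cvgM; [exact: cvg_cst|exact: cvg_id].
have := @derive0_trace_eq (fun y => (derive1 v y + r * v y) * expR (- r * y)) a b
  ((dva + r * va) * expR (- r * a)) ((dvb + r * vb) * expR (- r * b)) ab.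
move=> e.
have {e} : (dva + r * va) * expR (- r * a) = (dvb + r * vb) * expR (- r * b).
  apply: e.
  - move=> y /hv[dv ddv vE].
    have h1 : is_derive y (1 : R) v (derive1 v y) by rewrite derive1E; exact: derivableP.
    have h2 : is_derive y (1 : R) (derive1 v) (derive1 (derive1 v) y).
      by rewrite [derive1 (derive1 v) y]derive1E; exact: derivableP.
    have h3 := is_derive1_comp (is_derive_expR _) (is_derive_mull (- r) (is_derive_id y 1)).
    have h4 := is_deriveM (is_deriveD h2 (is_derive_mull r h1)) h3.
    refine (is_derive_eq h4 _).
    by rewrite vE /GRing.scale/= fctE; ring.
  - apply: cvgM; first by apply: cvgD => //; apply: cvgM => //; exact: cvg_cst.
    by apply: cvg_at_right_filter; exact: cexp.
  - apply: cvgM; first by apply: cvgD => //; apply: cvgM => //; exact: cvg_cst.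
    by apply: cvg_at_left_filter; exact: cexp.
move=> e; have -> : expR (r * (b - a)) = expR (- r * a) * expR (r * b).
  by rewrite -expRD; congr expR; ring.
transitivity ((dva + r * va) * expR (- r * a) * expR (r * b)); last by ring.
by rewrite e -mulrA -expRD mulNr addNr expR0 mulr1.
Qed.

(** For real [s] the real part solves the same equation. The two relations are [helmholtz_trace] at
    [r = sqrt s] and [r = - sqrt s], the first multiplied by [E] so that only decaying exponentials
    occur. *)
Lemma heat_hat_trace (v : R -> complex R) (a b s : R) : a < b -> 0 < s ->
  heat_hat_solution a b (complex.Complex s 0) v ->
  let E := expR (- (b - a) * Num.sqrt s) in
  let va := complex.Re (clim a^'+ v) in let vb := complex.Re (clim b^'- v) in
  let dva := complex.Re (clim a^'+ (cderive v)) in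
  let dvb := complex.Re (clim b^'- (cderive v)) in
  E * (dvb + Num.sqrt s * vb) = dva + Num.sqrt s * va /\
  dvb - Num.sqrt s * vb = E * (dva - Num.sqrt s * va).
Proof.
move=> ab s0 [dv hv [[va _] [vb _]] [[dva _] [dvb _]]] /=.
pose vR y := complex.Re (v y).
have hvR y : a < y < b -> [/\ derivable vR y 1, derivable (derive1 vR) y 1 &
    derive1 (derive1 vR) y = s * vR y].
  move=> yab; have [[dR _] [ddR _]] := dv y yab.
  split; [exact: dR|exact: ddR|].
  have := congr1 (@complex.Re R) (hv y yab).
  rewrite /vR; case: (v y) => vr vi /=; rewrite mul0r subr0 => /eqP.
  by rewrite subr_eq0 => /eqP <-.
split.
- rewrite (@helmholtz_trace vR a b (Num.sqrt s) _ _ _ _ ab _ va vb dva dvb).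
    by rewrite mulrA -expRD mulNr [_ * (b - a)]mulrC addNr expR0 mul1r.
  by move=> y /hvR; rewrite sqr_sqrtr ?ltW.
- rewrite -!mulNr (@helmholtz_trace vR a b (- Num.sqrt s) _ _ _ _ ab _ va vb dva dvb).
    by rewrite !mulNr [_ * (b - a)]mulrC.
  by move=> y /hvR; rewrite sqrrN sqr_sqrtr ?ltW.
Qed.

End heat_hat_traces.

(** * Majorants of rows *)

Section dominated.
Context {R : realType}.
Local Open Scope classical_set_scope.
Local Notation mu := (@lebesgue_measure R).
Implicit Types (phi F G : R -> R).

(** Analogue of [causal_op] for a row: several inputs [f j] share the bound [A], and the transform
    [phi] of the output is prescribed directly. *)
Definition dominated (f : nat -> R -> R) (N : nat) phi G := exists v, [/\ causal v,
  (forall s, 0 < s -> lap v s = phi s) &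
  forall T sigma A, 0 < sigma -> 0 <= A ->
    (forall j, (j <= N)%N -> expbounded T sigma A (f j)) ->
    expbounded T sigma (G sigma * A) v].

Lemma dominated_term f N j F G : (j <= N)%N -> causal (f j) -> causal_op F G ->
  dominated f N (fun s => F s * lap (f j) s) G.
Proof.
move=> jN cf /(_ _ cf)[v [cv lv bv]]; exists v; split => // T sigma A s0 A0 fA.
by apply: bv => //; exact: fA.
Qed.

Lemma dominatedD f N phi1 G1 phi2 G2 : dominated f N phi1 G1 -> dominated f N phi2 G2 ->
  dominated f N (fun s => phi1 s + phi2 s) (fun s => G1 s + G2 s).
Proof.
move=> [v1 [c1 l1 b1]] [v2 [c2 l2 b2]]; exists (fun t => v1 t + v2 t); split.
- exact: causalD.
- by move=> s s0; rewrite lapD// l1// l2.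
- move=> T sigma A s0 A0 fA.
  apply: (ae_mono2 (b1 _ _ _ s0 A0 fA) (b2 _ _ _ s0 A0 fA)) => t h1 h2 tT.
  by rewrite !mulrDl (le_trans (ler_normD _ _))// lerD// (h1,h2).
Qed.

(** The bound is known for the function built from convolutions; uniqueness of the Laplace transform
    carries it over to the given [v]. *)
Lemma dominated_bound f N phi G M v T sigma A : dominated f N phi G ->
  causal v -> (forall s, 0 < s -> lap v s = phi s) -> G sigma <= M ->
  0 < sigma -> 0 <= A -> (forall j, (j <= N)%N -> expbounded T sigma A (f j)) ->
  expbounded T sigma (M * A) v.
Proof.
move=> [v' [cv' lv' bv']] cv lv GM s0 A0 fA.
have vv' : \forall t \ae mu, v' t - v t = 0.
  apply: lerch; first exact: causalB.
  by move=> s ss; rewrite lapB// lv'// lv// subrr.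
apply: (ae_mono2 vv' (bv' _ _ _ s0 A0 fA)) => t /eqP; rewrite subr_eq0 => /eqP <- h tT.
by rewrite (le_trans (h tT))// ler_wpM2r ?expR_ge0// ler_wpM2r.
Qed.

Lemma causal_opB F1 G1 F2 G2 : causal_op F1 G1 -> causal_op F2 G2 ->
  causal_op (fun s => F1 s - F2 s) (fun s => G1 s + G2 s).
Proof.
move=> h1 /(causal_opZ (-1)) h2; apply: eq_causal_op (causal_opD h1 h2) => s _.
  by rewrite mulN1r.
by rewrite normrN1 mul1r.
Qed.

Definition expker (a s : R) : R := expR (- a * Num.sqrt s).

Lemma expker_ge0 (a s : R) : 0 <= expker a s. Proof. exact: expR_ge0. Qed.

Lemma expker_lt1 (a s : R) : 0 < a -> 0 < s -> expker a s < 1.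
Proof. by move=> a0 s0; rewrite expR_lt1 mulNr oppr_lt0 mulr_gt0// sqrtr_gt0. Qed.

Lemma expker_le (a b s : R) : a <= b -> expker b s <= expker a s.
Proof. by move=> ab; rewrite ler_expR !mulNr lerN2 ler_wpM2r// sqrtr_ge0. Qed.

Lemma expkerM2 (a s : R) : expker (2 * a) s = expker a s ^+ 2.
Proof. by rewrite /expker -expRM_natl; congr expR; ring. Qed.

Lemma geomkerE (a s : R) : geomker a s = expker a s ^+ 2 / (1 - expker a s ^+ 2).
Proof. by rewrite /geomker -/(expker (2 * a) s) expkerM2. Qed.

Lemma geomker_le (a b s : R) : 0 < a -> 0 < s -> a <= b -> geomker b s <= geomker a s.
Proof.
move=> a0 s0 ab; have b0 := lt_le_trans a0 ab; rewrite !geomkerE.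
have := expker_le s ab; have := expker_lt1 a0 s0; have := expker_lt1 b0 s0.
have := expker_ge0 a s; have := expker_ge0 b s.
move: (expker a s) (expker b s) => y z z0 y0 z1 y1 zy.
have zy2 : z ^+ 2 <= y ^+ 2 by rewrite lerXn2r ?nnegrE.
have y2 : y ^+ 2 < 1 by rewrite expr_lt1.
apply: ler_pM => //; first by rewrite exprn_ge0.
  by rewrite invr_ge0 subr_ge0 (le_trans zy2)// ltW.
by rewrite lef_pV2 ?posrE ?subr_gt0 ?(le_lt_trans zy2)// lerD2l lerN2.
Qed.

Lemma causal_op_expker (a : R) : 0 < a -> causal_op (expker a) (expker a).
Proof. by move=> a0; exact: causal_op_kernel (kernel_heat_kernel a0). Qed.

Lemma causal_op_geomker (a : R) : 0 < a -> causal_op (geomker a) (geomker a).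
Proof. by move=> a0; have [K [kK _]] := kernel_geomker a0; exact: causal_op_kernel kK. Qed.

Lemma causal_op_geomker1 (a : R) : 0 < a ->
  causal_op (fun s => 1 + geomker a s) (fun s => 1 + geomker a s).
Proof. by move=> a0; apply: causal_opD (causal_op_id) (causal_op_geomker a0). Qed.

Lemma geomker1_ge0 (a s : R) : 0 < a -> 0 < s -> 0 <= 1 + geomker a s.
Proof. by move=> a0 s0; rewrite addr_ge0// geomker_ge0. Qed.

(* [cosechker a s] is [1 / (2 * sinh (a * sqrt s))]. *)
Definition cosechker (a s : R) : R := expker a s * (1 + geomker a s).

Lemma cosechker_ge0 (a s : R) : 0 < a -> 0 < s -> 0 <= cosechker a s.
Proof. by move=> a0 s0; rewrite mulr_ge0 ?expker_ge0 ?geomker1_ge0. Qed.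

Lemma causal_op_cosechker (a : R) : 0 < a -> causal_op (cosechker a) (cosechker a).
Proof.
move=> a0; apply: causal_opM (causal_op_expker a0) (causal_op_geomker1 a0).
by move=> s s0; exact: geomker1_ge0.
Qed.

(* [tanhker a s] is [(1 - tanh (a * sqrt s)) / 2]. *)
Definition tanhker (a s : R) : R :=
  expker (2 * a) s * (1 + geomker (2 * a) s) - geomker (2 * a) s.

(** With [E = expker a s], the symbol is the alternating series [E^2 - E^4 + E^6 - ...]; the same
    terms with plus signs add up to [geomker a s]. *)
Lemma causal_op_tanhker (a : R) : 0 < a -> causal_op (tanhker a) (geomker a).
Proof.
move=> a0; have a20 : 0 < 2 * a by rewrite mulr_gt0.
have := causal_opB (causal_op_cosechker a20) (causal_op_geomker a20).
apply: eq_causal_op => s s0 //.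
rewrite /cosechker !geomkerE expkerM2.
have := expker_ge0 a s; have := expker_lt1 a0 s0; move: (expker a s) => y y1 y0.
by field; rewrite !subr_eq0 !gt_eqF ?expr_lt1 ?exprn_ge0.
Qed.

End dominated.

(** * The interface recurrence *)

Section nnwr_rows.
Context {R : realType}.
Local Open Scope classical_set_scope.
Local Notation mu := (@lebesgue_measure R).

(** Cutting at 0 makes an iterate causal and preserves its transform, an integral over []0,
    +oo[]. *)
Definition causal_part (f : R -> R) : R -> R := f \_ `]0, +oo[.

Lemma causal_causal_part (f : R -> R) : laplace_transformable f -> causal (causal_part f).
Proof.
move=> lf; split => [t t0|s s0].
  by rewrite /causal_part patchE mem_setE in_itv/= andbT ltNge t0.
have /integrable_mkcond := lf s s0; move=> /(_ (measurable_itv _)).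
apply: eq_integrable => // t _ /=.
by rewrite /causal_part !patchE; case: ifPn => //; rewrite mulr0.
Qed.

Lemma Re_laplace (f : R -> R) (s : R) :
  complex.Re (laplace f (complex.Complex s 0)) = lap (causal_part f) s.
Proof.
rewrite /laplace /cintegral /= Rintegral_mkcond /lap; apply: eq_Rintegral => t _.
rewrite /causal_part !patchE; case: ifPn => _; last by rewrite mulr0.
by rewrite /= !(mulr0, mul0r, oppr0, addr0, subr0, cos0, mulr1, mulNr).
Qed.

Lemma dirichlet_to_neumann (E r va vb dva dvb : R) : 1 - E ^+ 2 != 0 ->
  E * (dvb + r * vb) = dva + r * va -> dvb - r * vb = E * (dva - r * va) ->
  dvb = r * ((1 + E ^+ 2) / (1 - E ^+ 2) * vb - 2 * E / (1 - E ^+ 2) * va) /\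
  dva = r * (2 * E / (1 - E ^+ 2) * vb - (1 + E ^+ 2) / (1 - E ^+ 2) * va).
Proof.
move=> E1 h1 h2.
have e1 : (1 - E ^+ 2) * dvb = r * ((1 + E ^+ 2) * vb - 2 * E * va).
  have := congr1 (fun z => E * z) h1; rewrite /= => h3; lra.
have e2 : (1 - E ^+ 2) * dva = r * (2 * E * vb - (1 + E ^+ 2) * va).
  have := congr1 (fun z => E * z) h2; rewrite /= => h3; lra.
by split; apply: (mulfI E1); rewrite ?e1 ?e2; field.
Qed.

Lemma neumann_to_dirichlet (E r va vb dva dvb : R) : 1 - E ^+ 2 != 0 -> r != 0 ->
  E * (dvb + r * vb) = dva + r * va -> dvb - r * vb = E * (dva - r * va) ->
  vb = ((1 + E ^+ 2) / (1 - E ^+ 2) * dvb - 2 * E / (1 - E ^+ 2) * dva) / r /\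
  va = (2 * E / (1 - E ^+ 2) * dvb - (1 + E ^+ 2) / (1 - E ^+ 2) * dva) / r.
Proof.
move=> E1 r0 h1 h2.
have e1 : (1 - E ^+ 2) * (r * vb) = (1 + E ^+ 2) * dvb - 2 * E * dva.
  have := congr1 (fun z => E * z) h1; rewrite /= => h3; lra.
have e2 : (1 - E ^+ 2) * (r * va) = 2 * E * dvb - (1 + E ^+ 2) * dva.
  have := congr1 (fun z => E * z) h2; rewrite /= => h3; lra.
by split; apply: (mulfI r0); apply: (mulfI E1); rewrite ?e1 ?e2; field; rewrite r0 E1.
Qed.

Lemma ReB (z1 z2 : complex R) : complex.Re (z1 - z2) = complex.Re z1 - complex.Re z2.
Proof. by case: z1 z2 => a b []. Qed.

Lemma ReD (z1 z2 : complex R) : complex.Re (z1 + z2) = complex.Re z1 + complex.Re z2.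
Proof. by case: z1 z2 => a b []. Qed.

Lemma ReN (z : complex R) : complex.Re (- z) = - complex.Re z.
Proof. by case: z. Qed.

Lemma Re_scale (c : R) (z : complex R) :
  complex.Re (complex.Complex c 0 * z) = c * complex.Re z.
Proof. by case: z => a b /=; rewrite mul0r subr0. Qed.

Variables (N : nat) (x : nat -> R) (w : nat -> nat -> R -> R).
Variables (u psi : nat -> nat -> complex R -> R -> complex R).
Hypothesis hx : forall i, (i < N)%N -> x i < x i.+1.
Hypothesis hw : nnwr N x (4%:R^-1) w u psi.

Local Notation h j := (x j - x j.-1).

Lemma nnwr_step_gt0 j : (1 <= j <= N)%N -> 0 < h j.
Proof. by case: j => // j /andP[_ jN]; rewrite subr_gt0 hx. Qed.

Section fixed_frequency.
Variables (k : nat) (s : R) (s0 : 0 < s).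

Let sc := complex.Complex s 0.
Let r := Num.sqrt s.
Local Notation E j := (expker (h j) s).
(** [c j] and [d j] are [coth] and [1 / sinh] of [h_j sqrt s]. *)
Let c j := (1 + E j ^+ 2) / (1 - E j ^+ 2).
Let d j := 2 * E j / (1 - E j ^+ 2).
Local Notation W j := (lap (causal_part (w k j)) s).
Local Notation W' j := (lap (causal_part (w k.+1 j)) s).
Local Notation S j := (geomker (h j) s).
Local Notation Z j := (cosechker (h j) s).
Let dul j := complex.Re (clim (x j.-1)^'+ (cderive (u k.+1 j sc))).
Let dur j := complex.Re (clim (x j)^'- (cderive (u k.+1 j sc))).
Let pl j := complex.Re (clim (x j.-1)^'+ (psi k.+1 j sc)).
Let pr j := complex.Re (clim (x j)^'- (psi k.+1 j sc)).
(** The flux jump at [x i] divided by [r]; see [flux]. This [r] cancels the division by [r] in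
    [psi_trace]. *)
Let f i := (c i + c i.+1) * W i - d i * W i.-1 - d i.+1 * W i.+1.

Let r0 : r != 0. Proof. by rewrite gt_eqF// sqrtr_gt0. Qed.

Let En j : (1 <= j <= N)%N -> 1 - E j ^+ 2 != 0.
Proof.
move=> jN; rewrite subr_eq0 gt_eqF// expr_lt1 ?expker_ge0//.
by apply: expker_lt1 => //; exact: nnwr_step_gt0.
Qed.

Let xlt j : (1 <= j <= N)%N -> x j.-1 < x j.
Proof. by move=> jN; rewrite -subr_gt0; exact: nnwr_step_gt0. Qed.

Let dirichlet j : (1 <= j <= N)%N ->
  dur j = r * (c j * W j - d j * W j.-1) /\ dul j = r * (d j * W j - c j * W j.-1).
Proof.
move=> jN; have [hu ul ur] := nnwr_dirichlet hw k (s := sc) jN s0.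
have [h1 h2] := heat_hat_trace (xlt jN) s0 hu.
have := dirichlet_to_neumann (En jN) h1 h2.
by rewrite ul ur !Re_laplace.
Qed.

Let flux i : (1 <= i < N)%N -> dur i - dul i.+1 = r * f i.
Proof.
move=> /andP[i1 iN].
have [-> _] : dur i = _ /\ _ := dirichlet (j := i) ltac:(by rewrite i1 ltnW).
have [_ ->] := dirichlet (j := i.+1) ltac:(by []).
by rewrite /f /=; ring.
Qed.

Let dpl j := complex.Re (clim (x j.-1)^'+ (cderive (psi k.+1 j sc))).
Let dpr j := complex.Re (clim (x j)^'- (cderive (psi k.+1 j sc))).

Let psi_trace j : (1 <= j <= N)%N ->
  pr j = (c j * dpr j - d j * dpl j) / r /\ pl j = (d j * dpr j - c j * dpl j) / r.
Proof.
move=> jN; have [hp _ _] := nnwr_neumann hw k (s := sc) jN s0.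
have [h1 h2] := heat_hat_trace (xlt jN) s0 hp.
exact: neumann_to_dirichlet (En jN) r0 h1 h2.
Qed.

Let dprE j : (1 <= j < N)%N -> dpr j = r * f j.
Proof.
move=> jN; rewrite -flux//; case/andP: jN => j1 jN.
have [|_ _] := nnwr_neumann hw k (i := j) (s := sc) _ s0; first by rewrite j1 ltnW.
by rewrite (ltn_eqF jN) => /(congr1 (@complex.Re R)); rewrite ReB.
Qed.

Let dplE j : (1 <= j < N)%N -> dpl j.+1 = - (r * f j).
Proof.
move=> jN; rewrite -flux//; case/andP: jN => j1 jN.
have [//|_ + _] := nnwr_neumann hw k (i := j.+1) (s := sc) _ s0.
rewrite eqSS (gtn_eqF j1) => /(congr1 (@complex.Re R)); rewrite ReN ReB => <-.
by rewrite opprK.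
Qed.

Let c0 j : (1 <= j <= N)%N -> c j != 0.
Proof.
move=> jN; rewrite /c mulf_neq0 ?invr_eq0 ?En// gt_eqF//.
by rewrite ltr_wpDr ?ltr01 ?exprn_ge0 ?expker_ge0.
Qed.

Let c2d2 j : (1 <= j <= N)%N -> d j ^+ 2 = c j ^+ 2 - 1.
Proof. by move=> jN; rewrite /c /d; field; exact: En. Qed.

Let psi_right i : (1 <= i < N)%N ->
  pr i = if i == 1%N then f i / c i else c i * f i + d i * f i.-1.
Proof.
move=> iN; have iN' : (1 <= i <= N)%N by case/andP: iN => -> /ltnW.
have [e1 e2] := psi_trace iN'; rewrite dprE// in e1 e2.
case: eqP => [i1|/eqP i1].
  (* The outer Dirichlet condition eliminates the unknown left flux; by [d^2 = c^2 - 1] the factor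
     [c - d^2 / c] becomes [1 / c]. *)
  have pl0 : pl i = 0.
    have [_ + _] := nnwr_neumann hw k (i := i) (s := sc) iN' s0.
    by rewrite /pl i1 eqxx => /(congr1 (@complex.Re R)).
  have hd : dpl i = d i * (r * f i) / c i.
    move: e2; rewrite pl0 => /esym/eqP; rewrite mulf_eq0 invr_eq0 (negbTE r0) orbF.
    by rewrite subr_eq0 => /eqP ->; rewrite mulrC mulKf// c0.
  rewrite e1 hd [d i * (d i * _ / _)](_ : _ = d i ^+ 2 * (r * f i) / c i); last by ring.
  by rewrite c2d2//; field; rewrite r0 c0.
have -> : pr i = (c i * (r * f i) + d i * (r * f i.-1)) / r.
  rewrite e1; case: i i1 {iN' e1 e2} iN => [|[|i]]// _ /andP[_ iN].
  by rewrite (dplE (j := i.+1)) ?(ltnW iN)// mulrN opprK.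
by field.
Qed.

Let psi_left i : (1 <= i < N)%N ->
  pl i.+1 = if i.+1 == N then f i / c i.+1 else d i.+1 * f i.+1 + c i.+1 * f i.
Proof.
move=> iN; have iN' : (1 <= i.+1 <= N)%N by case/andP: iN.
have [e1 e2] := psi_trace iN'; rewrite dplE// in e1 e2.
case: eqP => [i1|/eqP i1].
  have pr0 : pr i.+1 = 0.
    have [_ _] := nnwr_neumann hw k (i := i.+1) (s := sc) iN' s0.
    by rewrite /pr i1 eqxx => /(congr1 (@complex.Re R)).
  have hd : dpr i.+1 = - (d i.+1 * (r * f i) / c i.+1).
    move: e1; rewrite pr0 => /esym/eqP; rewrite mulf_eq0 invr_eq0 (negbTE r0) orbF.
    rewrite mulrN opprK addrC addr_eq0 => /eqP ->.
    by rewrite mulNr opprK mulrAC divff ?mul1r// c0.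
  rewrite e2 hd mulrN [d i.+1 * (d i.+1 * _ / _)](_ : _ = d i.+1 ^+ 2 * (r * f i) / c i.+1); last by ring.
  by rewrite c2d2//; field; rewrite r0 c0.
rewrite e2 dprE//; last by rewrite /= ltn_neqAle i1 (andP iN').2.
by field.
Qed.

Let transfer i : (1 <= i < N)%N ->
  W' i = W i - 4^-1 * ((if i == 1%N then f i / c i else c i * f i + d i * f i.-1) +
    (if i.+1 == N then f i / c i.+1 else d i.+1 * f i.+1 + c i.+1 * f i)).
Proof.
move=> iN; rewrite -psi_right// -psi_left//.
have := congr1 (@complex.Re R) (nnwr_update hw k (s := sc) iN s0).
rewrite ReB Re_scale ReD !Re_laplace => e.
exact: e.
Qed.

Lemma lap_outer j : (j == 0%N) || (j == N) -> W j = 0.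
Proof.
move=> j0N; rewrite /lap /Rintegral integral0_eq// => t _.
rewrite /causal_part patchE; case: ifPn => _; last by rewrite mulr0.
by have [w0 wN] := nnwr_outer hw k t; case/orP: j0N => /eqP ->; rewrite ?w0 ?wN mulr0.
Qed.

Let En' j : (1 <= j <= N)%N -> 1 + E j ^+ 2 != 0.
Proof. by move=> jN; rewrite gt_eqF// ltr_wpDr ?ltr01 ?exprn_ge0 ?expker_ge0. Qed.

Let En4 j : (1 <= j <= N)%N -> 1 - E j ^+ 2 ^+ 2 != 0.
Proof.
move=> jN; rewrite (_ : _ - _ = (1 - E j ^+ 2) * (1 + E j ^+ 2)); last by ring.
by rewrite mulf_neq0 ?En ?En'.
Qed.

(** For [theta = 1/4] the diagonal coefficient is [(1 - c_i c_(i+1)) / 2], by [d^2 = c^2 - 1]: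
    substituting [c = 1 + 2 S] the constants cancel and only decaying terms survive. For the
    neighbours [c_i] cancels and a difference of two other [c] remains. *)
Lemma nnwr_row_interior i : (1 < i)%N -> (i.+1 < N)%N ->
  W' i = - (S i * (1 + S i.+1) + (1 + S i) * S i.+1) * W i +
    (- Z i * (S i.-1 - S i.+1)) * W i.-1 + (- Z i.+1 * (S i.+2 - S i)) * W i.+1 +
    Z i * Z i.-1 * W i.-2 + Z i.+1 * Z i.+2 * W i.+2.
Proof.
case: i => [|[|i]]// _ iN; rewrite transfer ?(ltnW iN)//.
rewrite [_ == 1%N]/= (ltn_eqF iN) /f /= /c /d /cosechker !geomkerE.
have n1 : 1 - E i.+1 ^+ 2 != 0 by apply: En; rewrite /= -ltnS ltnW// ltnW// ltnW.
have n2 : 1 - E i.+2 ^+ 2 != 0 by apply: En; rewrite /= ltnW// ltnW.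
have n3 : 1 - E i.+3 ^+ 2 != 0 by apply: En; rewrite /= ltnW.
have n4 : 1 - E i.+4 ^+ 2 != 0 by apply: En.
move: n1 n2 n3 n4 => /=.
move: (expker (x i.+1 - x i) s) (expker (x i.+2 - x i.+1) s) => e1 e2.
move: (expker (x i.+3 - x i.+2) s) (expker (x i.+4 - x i.+3) s) => e3 e4 n1 n2 n3 n4.
by field; rewrite n1 n2 n3 n4.
Qed.

(** The doubled width comes from [c_1 + 1 / c_1 = 2 coth (2 h_1 sqrt s)], where [1 / c_1] is due to
    the outer Dirichlet condition; alone, [1 / c_1 = 1 - 2 tanhker]. *)
Lemma nnwr_row_left : (2 < N)%N ->
  W' 1 = - (geomker (2 * h 1%N) s * (1 + S 2) + (1 + geomker (2 * h 1%N) s) * S 2) * W 1 +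
    (- Z 2 * (S 3 + tanhker (h 1%N) s)) * W 2 + Z 2 * Z 3 * W 3.
Proof.
move=> N3; have W0 : W 0%N = 0 by apply: lap_outer.
rewrite transfer ?(ltnW N3)// eqxx (ltn_eqF N3) /f /= W0 /c /d /cosechker /tanhker.
rewrite !geomkerE !expkerM2.
have n1 : 1 - E 1 ^+ 2 != 0 by apply: En; rewrite /= (ltnW (ltnW N3)).
have m1 : 1 + E 1 ^+ 2 != 0 by apply: En'; rewrite /= (ltnW (ltnW N3)).
have l1 : 1 - E 1 ^+ 2 ^+ 2 != 0 by apply: En4; rewrite /= (ltnW (ltnW N3)).
have n2 : 1 - E 2 ^+ 2 != 0 by apply: En; rewrite /= (ltnW N3).
have n3 : 1 - E 3 ^+ 2 != 0 by apply: En.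
move: n1 m1 l1 n2 n3 => /=.
move: (expker (x 1 - x 0) s) (expker (x 2 - x 1) s) (expker (x 3 - x 2) s).
move=> e1 e2 e3 n1 m1 l1 n2 n3.
by field; rewrite n1 m1 l1 n2 n3.
Qed.

Lemma nnwr_row_right i : (1 < i)%N -> i.+1 = N ->
  W' i = - (S i * (1 + geomker (2 * h N) s) + (1 + S i) * geomker (2 * h N) s) * W i +
    (- Z i * (S i.-1 + tanhker (h N) s)) * W i.-1 + Z i * Z i.-1 * W i.-2.
Proof.
case: i => [|[|i]]// _ iN; rewrite transfer; last by rewrite -iN ltnSn.
rewrite [_ == 1%N]/= iN eqxx -iN.
have WN : W i.+3 = 0 by apply: lap_outer; rewrite iN eqxx orbT.
rewrite /f /= WN /c /d /cosechker /tanhker !geomkerE !expkerM2.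
have n1 : 1 - E i.+1 ^+ 2 != 0.
  by apply: En; rewrite -iN /= (leq_trans (leqnSn i.+1) (leqnSn i.+2)).
have n2 : 1 - E i.+2 ^+ 2 != 0 by apply: En; rewrite -iN /= leqnSn.
have n3 : 1 - E i.+3 ^+ 2 != 0 by apply: En; rewrite -iN /= leqnn.
have m3 : 1 + E i.+3 ^+ 2 != 0 by apply: En'; rewrite -iN /= leqnn.
have l3 : 1 - E i.+3 ^+ 2 ^+ 2 != 0 by apply: En4; rewrite -iN /= leqnn.
move: n1 n2 n3 m3 l3 => /=.
move: (expker (x i.+1 - x i) s) (expker (x i.+2 - x i.+1) s) (expker (x i.+3 - x i.+2) s).
move=> e1 e2 e3 n1 n2 n3 m3 l3.
by field; rewrite n1 n2 n3 m3 l3.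
Qed.

(** With both outer conditions present the factor is [- (c_1 - c_2)^2 / (4 c_1 c_2)]. *)
Lemma nnwr_row_two : N = 2%N ->
  W' 1 = - ((S 1 - S 2) * (tanhker (h 1%N) s - tanhker (h 2%N) s)) * W 1.
Proof.
move=> N2; have W0 : W 0%N = 0 by apply: lap_outer.
have W2 : W 2 = 0 by apply: lap_outer; rewrite N2.
rewrite transfer ?N2// eqxx /f /= W0 W2 /c /d /tanhker.
rewrite !geomkerE !expkerM2.
have n1 : 1 - E 1 ^+ 2 != 0 by apply: En; rewrite N2.
have m1 : 1 + E 1 ^+ 2 != 0 by apply: En'; rewrite N2.
have l1 : 1 - E 1 ^+ 2 ^+ 2 != 0 by apply: En4; rewrite N2.
have n2 : 1 - E 2 ^+ 2 != 0 by apply: En; rewrite N2.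
have m2 : 1 + E 2 ^+ 2 != 0 by apply: En'; rewrite N2.
have l2 : 1 - E 2 ^+ 2 ^+ 2 != 0 by apply: En4; rewrite N2.
move: n1 m1 l1 n2 m2 l2 => /=.
move: (expker (x 1 - x 0) s) (expker (x 2 - x 1) s) => e1 e2 n1 m1 l1 n2 m2 l2.
by field; rewrite n1 m1 l1 n2 m2 l2.
Qed.

End fixed_frequency.
End nnwr_rows.

(** * Contraction in the weighted norm *)

Section contraction.
Context {R : realType}.
Local Open Scope classical_set_scope.
Local Notation mu := (@lebesgue_measure R).

(** Majorant of an absolute row sum: [2 S (1 + S)] for the diagonal, [S (1 + S)] for each of the two
    farthest terms, [Z S] for each neighbour, with [Z = E (1 + S)]. *)
Definition nnwr_rate (hm s : R) : R :=
  2 * geomker hm s * (1 + geomker hm s) * (2 + expker hm s).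

Lemma nnwr_rate_ge0 (hm s : R) : 0 < hm -> 0 < s -> 0 <= nnwr_rate hm s.
Proof.
move=> h0 s0; rewrite mulr_ge0 ?addr_ge0 ?expker_ge0// mulr_ge0 ?geomker1_ge0//.
by rewrite mulr_ge0// geomker_ge0.
Qed.

Lemma causal_opN (F G : R -> R) : causal_op F G -> causal_op (fun s => - F s) G.
Proof.
by move=> /(causal_opZ (-1)); apply: eq_causal_op => s _; rewrite ?normrN1 ?mul1r ?mulN1r.
Qed.

(** * Bounds of the coefficients through the smallest width *)

Section majorants.
Variables (hm s : R) (hm0 : 0 < hm) (s0 : 0 < s).
Local Notation S := (geomker hm s).
Local Notation Z := (cosechker hm s).

Let pos a : hm <= a -> 0 < a. Proof. exact: lt_le_trans. Qed.

Let leS a : hm <= a -> geomker a s <= S. Proof. exact: geomker_le. Qed.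

Let leZ a : hm <= a -> cosechker a s <= Z.
Proof.
move=> ha; have a0 := pos ha.
by rewrite ler_pM ?expker_ge0 ?geomker1_ge0 ?expker_le// lerD2l leS.
Qed.

Lemma geomker_mulD_le a b : hm <= a -> hm <= b ->
  geomker a s * (1 + geomker b s) + (1 + geomker a s) * geomker b s <= 2 * S * (1 + S).
Proof.
move=> ha hb; have a0 := pos ha; have b0 := pos hb.
have h c e : hm <= c -> hm <= e -> geomker c s * (1 + geomker e s) <= S * (1 + S).
  move=> hc he; have c0 := pos hc; have e0 := pos he.
  by rewrite ler_pM ?geomker1_ge0 ?geomker_ge0 ?lerD2l ?leS.
have := h _ _ ha hb; have := h _ _ hb ha; lra.
Qed.

(** [Z^2 = S (1 + S)] is the identity [1 / sinh^2 = coth^2 - 1]. *)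
Lemma cosechkerM_le a b : hm <= a -> hm <= b ->
  cosechker a s * cosechker b s <= S * (1 + S).
Proof.
move=> ha hb; have a0 := pos ha; have b0 := pos hb.
apply: (@le_trans _ _ (Z * Z)).
  by rewrite ler_pM ?cosechker_ge0 ?leZ.
rewrite /cosechker !geomkerE.
have := expker_ge0 hm s; have := expker_lt1 hm0 s0; move: (expker hm s) => y y1 y0.
rewrite le_eqVlt; apply/orP; left; apply/eqP.
by field; rewrite subr_eq0 gt_eqF// expr_lt1.
Qed.

Lemma cosechker_geomkerB_le a b c : hm <= a -> hm <= b -> hm <= c ->
  cosechker a s * `|geomker b s - geomker c s| <= Z * S.
Proof.
move=> ha hb hc; have a0 := pos ha; have b0 := pos hb; have c0 := pos hc.
rewrite ler_pM ?cosechker_ge0 ?leZ// ler_norml.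
have := leS hb; have := leS hc; have := geomker_ge0 b0 s0; have := geomker_ge0 c0 s0.
by move=> ? ? ? ?; apply/andP; split; lra.
Qed.

(** For the boundary rows: the norms of the two symbols are added there, but a single neighbour
    occurs, so the total [2 Z S] of two interior neighbours suffices. *)
Lemma cosechker_geomkerD_le a b c : hm <= a -> hm <= b -> hm <= c ->
  cosechker a s * (geomker b s + geomker c s) <= 2 * (Z * S).
Proof.
move=> ha hb hc; have a0 := pos ha; have b0 := pos hb; have c0 := pos hc.
rewrite [leRHS]mulrCA ler_pM ?cosechker_ge0 ?leZ ?addr_ge0 ?geomker_ge0//.
by have := leS hb; have := leS hc; lra.
Qed.

Lemma nnwr_rateE : nnwr_rate hm s = 4 * (S * (1 + S)) + 2 * (Z * S).
Proof. by rewrite /nnwr_rate /cosechker; ring. Qed.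

End majorants.

Variables (N : nat) (x : nat -> R) (w : nat -> nat -> R -> R).
Variables (u psi : nat -> nat -> complex R -> R -> complex R).
Hypotheses (hN : (2 <= N)%N) (hx : forall i, (i < N)%N -> x i < x i.+1).
Hypothesis hw : nnwr N x (4%:R^-1) w u psi.
Local Notation h j := (x j - x j.-1).
Variables (hm : R) (hm0 : 0 < hm) (hmE : forall j, (1 <= j <= N)%N -> hm <= h j).
Local Notation wt k j := (causal_part (w k j)).

Let cw k j : (j <= N)%N -> causal (wt k j).
Proof. by move=> jN; apply/causal_causal_part/(nnwr_transformable hw). Qed.

Let hpos j : (1 <= j <= N)%N -> 0 < h j.
Proof. by move=> /hmE; exact: lt_le_trans. Qed.

(** * One step of the iteration in the weighted norm *)

Section step.
Variables (k : nat) (T sigma A : R) (sigma0 : 0 < sigma) (A0 : 0 <= A).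
Hypothesis wA : forall j, (j <= N)%N -> expbounded T sigma A (wt k j).
Local Notation S j := (geomker (h j)).
Local Notation goal i := (expbounded T sigma (nnwr_rate hm sigma * A) (wt k.+1 i)).

Let op_SS (a b : R) : 0 < a -> 0 < b ->
  causal_op (fun s => - (geomker a s * (1 + geomker b s) + (1 + geomker a s) * geomker b s))
    (fun s => geomker a s * (1 + geomker b s) + (1 + geomker a s) * geomker b s).
Proof.
move=> a0 b0; apply: causal_opN; apply: causal_opD; apply: causal_opM.
- by move=> s s0; exact: geomker1_ge0.
- exact: causal_op_geomker.
- exact: causal_op_geomker1.
- by move=> s s0; exact: geomker_ge0.
- exact: causal_op_geomker1.
- exact: causal_op_geomker.
Qed.

Let op_ZD (a b c : R) : 0 < a -> 0 < b -> 0 < c ->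
  causal_op (fun s => - cosechker a s * (geomker b s - geomker c s))
    (fun s => cosechker a s * `|geomker b s - geomker c s|).
Proof.
move=> a0 b0 c0; apply: causal_opM => //; last exact: causal_op_geomker_diff.
by apply/causal_opN/causal_op_cosechker.
Qed.

Let op_ZT (a b c : R) : 0 < a -> 0 < b -> 0 < c ->
  causal_op (fun s => - cosechker a s * (geomker b s + tanhker c s))
    (fun s => cosechker a s * (geomker b s + geomker c s)).
Proof.
move=> a0 b0 c0; apply: causal_opM.
- by move=> s s0; rewrite addr_ge0 ?geomker_ge0.
- by apply/causal_opN/causal_op_cosechker.
- by apply: causal_opD; [exact: causal_op_geomker|exact: causal_op_tanhker].
Qed.

Let op_ZZ (a b : R) : 0 < a -> 0 < b ->
  causal_op (fun s => cosechker a s * cosechker b s) (fun s => cosechker a s * cosechker b s).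
Proof.
move=> a0 b0; apply: causal_opM; [|exact: causal_op_cosechker..].
by move=> s s0; exact: cosechker_ge0.
Qed.

Let step_interior i : (1 < i)%N -> (i.+1 < N)%N -> goal i.
Proof.
case: i => [|[|i]]// _ iN.
have h1 : (1 <= i.+1 <= N)%N by rewrite /= -ltnS ltnW// ltnW// ltnW.
have h2 : (1 <= i.+2 <= N)%N by rewrite /= ltnW// ltnW.
have h3 : (1 <= i.+3 <= N)%N by rewrite /= ltnW.
have h4 : (1 <= i.+4 <= N)%N by [].
have dom := dominatedD (dominatedD (dominatedD (dominatedD
  (dominated_term (f := fun j => wt k j) (j := i.+2) (N := N) (andP h2).2 (cw k (andP h2).2)
     (op_SS (hpos h2) (hpos h3)))
  (dominated_term (f := fun j => wt k j) (j := i.+1) (N := N) (andP h1).2 (cw k (andP h1).2)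
     (op_ZD (hpos h2) (hpos h1) (hpos h3))))
  (dominated_term (f := fun j => wt k j) (j := i.+3) (N := N) (andP h3).2 (cw k (andP h3).2)
     (op_ZD (hpos h3) (hpos h4) (hpos h2))))
  (dominated_term (f := fun j => wt k j) (j := i) (N := N) (ltnW (andP h1).2) (cw k (ltnW (andP h1).2))
     (op_ZZ (hpos h2) (hpos h1))))
  (dominated_term (f := fun j => wt k j) (j := i.+4) (N := N) (andP h4).2 (cw k (andP h4).2)
     (op_ZZ (hpos h3) (hpos h4))).
apply: (dominated_bound dom) => //.
- exact: cw (andP h2).2.
- by move=> s s0; rewrite (nnwr_row_interior hx hw k s0 (i := i.+2)).
rewrite nnwr_rateE.
have := geomker_mulD_le hm0 sigma0 (hmE h2) (hmE h3).
have := cosechker_geomkerB_le hm0 sigma0 (hmE h2) (hmE h1) (hmE h3).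
have := cosechker_geomkerB_le hm0 sigma0 (hmE h3) (hmE h4) (hmE h2).
have := cosechkerM_le hm0 sigma0 (hmE h2) (hmE h1).
have := cosechkerM_le hm0 sigma0 (hmE h3) (hmE h4).
rewrite /=; lra.
Qed.

Let step_left : (2 < N)%N -> goal 1%N.
Proof.
move=> N3.
have h1 : (1 <= 1 <= N)%N by rewrite /= ltnW.
have h2 : (1 <= 2 <= N)%N by [].
have h3 : (1 <= 3 <= N)%N by [].
have h11 : 0 < 2 * h 1%N by rewrite mulr_gt0 ?hpos.
have hm1 : hm <= 2 * h 1%N by have := hmE h1; have := hpos h1; lra.
have dom := dominatedD (dominatedD
  (dominated_term (f := fun j => wt k j) (j := 1%N) (N := N) (andP h1).2 (cw k (andP h1).2)
     (op_SS h11 (hpos h2)))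
  (dominated_term (f := fun j => wt k j) (j := 2%N) (N := N) (andP h2).2 (cw k (andP h2).2)
     (op_ZT (hpos h2) (hpos h3) (hpos h1))))
  (dominated_term (f := fun j => wt k j) (j := 3%N) (N := N) (andP h3).2 (cw k (andP h3).2)
     (op_ZZ (hpos h2) (hpos h3))).
apply: (dominated_bound dom) => //.
- exact: cw (andP h1).2.
- by move=> s s0; rewrite (nnwr_row_left hx hw k s0).
rewrite nnwr_rateE.
have := geomker_mulD_le hm0 sigma0 hm1 (hmE h2).
have := cosechker_geomkerD_le hm0 sigma0 (hmE h2) (hmE h3) (hmE h1).
have := cosechkerM_le hm0 sigma0 (hmE h2) (hmE h3).
have : 0 <= geomker hm sigma * (1 + geomker hm sigma).
  by rewrite mulr_ge0 ?geomker1_ge0 ?geomker_ge0.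
rewrite /=; lra.
Qed.

Let step_right i : (1 < i)%N -> i.+1 = N -> goal i.
Proof.
case: i => [|[|i]]// _ iN.
have h1 : (1 <= i.+1 <= N)%N by rewrite /= -iN (leq_trans (leqnSn i.+1) (leqnSn i.+2)).
have h2 : (1 <= i.+2 <= N)%N by rewrite /= -iN leqnSn.
have h3 : (1 <= N <= N)%N by rewrite leqnn ltnW.
have h33 : 0 < 2 * h N by rewrite mulr_gt0 ?hpos.
have hm3 : hm <= 2 * h N by have := hmE h3; have := hpos h3; lra.
have dom := dominatedD (dominatedD
  (dominated_term (f := fun j => wt k j) (j := i.+2) (N := N) (andP h2).2 (cw k (andP h2).2)
     (op_SS (hpos h2) h33))
  (dominated_term (f := fun j => wt k j) (j := i.+1) (N := N) (andP h1).2 (cw k (andP h1).2)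
     (op_ZT (hpos h2) (hpos h1) (hpos h3))))
  (dominated_term (f := fun j => wt k j) (j := i) (N := N) (ltnW (andP h1).2) (cw k (ltnW (andP h1).2))
     (op_ZZ (hpos h2) (hpos h1))).
apply: (dominated_bound dom) => //.
- exact: cw (andP h2).2.
- by move=> s s0; rewrite (nnwr_row_right hx hw k s0 (i := i.+2)).
rewrite nnwr_rateE.
have := geomker_mulD_le hm0 sigma0 (hmE h2) hm3.
have := cosechker_geomkerD_le hm0 sigma0 (hmE h2) (hmE h1) (hmE h3).
have := cosechkerM_le hm0 sigma0 (hmE h2) (hmE h1).
have : 0 <= geomker hm sigma * (1 + geomker hm sigma).
  by rewrite mulr_ge0 ?geomker1_ge0 ?geomker_ge0.
rewrite /=; lra.
Qed.

Let step_two : N = 2%N -> goal 1%N.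
Proof.
move=> N2.
have h1 : (1 <= 1 <= N)%N by rewrite N2.
have h2 : (1 <= 2 <= N)%N by rewrite N2.
have op : causal_op
   (fun s => - ((S 1%N s - S 2%N s) * (tanhker (h 1%N) s - tanhker (h 2%N) s)))
   (fun s => `|S 1%N s - S 2%N s| * (S 1%N s + S 2%N s)).
  apply: causal_opN; apply: causal_opM.
  - by move=> s s0; rewrite addr_ge0 ?geomker_ge0 ?hpos.
  - by apply: causal_op_geomker_diff; exact: hpos.
  - by apply: causal_opB; apply: causal_op_tanhker; exact: hpos.
apply: (dominated_bound (dominated_term (f := fun j => wt k j) (j := 1%N) (N := N)
   (andP h1).2 (cw k (andP h1).2) op)) => //.
- exact: cw (andP h1).2.
- by move=> s s0; rewrite (nnwr_row_two hx hw k s0).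
rewrite nnwr_rateE.
have l1 := geomker_le hm0 sigma0 (hmE h1); have l2 := geomker_le hm0 sigma0 (hmE h2).
have p1 := geomker_ge0 (hpos h1) sigma0; have p2 := geomker_ge0 (hpos h2) sigma0.
have p0 := geomker_ge0 hm0 sigma0; have pz := cosechker_ge0 hm0 sigma0.
have hD : `|S 1%N sigma - S 2%N sigma| <= geomker hm sigma.
  by rewrite ler_norml; apply/andP; split; lra.
have : `|S 1%N sigma - S 2%N sigma| * (S 1%N sigma + S 2%N sigma) <=
    geomker hm sigma * (2 * geomker hm sigma).
  by rewrite ler_pM ?addr_ge0//; lra.
have := mulr_ge0 pz p0; have := mulr_ge0 p0 p0; lra.
Qed.

Lemma nnwr_step i : (i <= N)%N -> goal i.
Proof.
move=> iN; have [i0N|] := boolP ((i == 0%N) || (i == N)).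
  apply: nearW => t _; rewrite /causal_part patchE; have [w0 wN] := nnwr_outer hw k.+1 t.
  have -> : w k.+1 i t = 0 by case/orP: i0N => /eqP ->.
  by rewrite if_same normr0 mulr_ge0 ?expR_ge0// mulr_ge0 ?nnwr_rate_ge0.
rewrite negb_or -lt0n => /andP[i0 inN].
have iN' : (i < N)%N by rewrite ltn_neqAle inN iN.
have [i1|i1] := leqP i 1%N.
  have -> : i = 1%N by apply/eqP; rewrite eqn_leq i1 i0.
  by move: hN; rewrite leq_eqVlt => /predU1P[/esym|]; [exact: step_two|exact: step_left].
by move: iN'; rewrite leq_eqVlt => /predU1P[|]; [exact: step_right|exact: step_interior].
Qed.

End step.

Lemma nnwr_contraction (T sigma A : R) k : 0 < sigma -> 0 <= A ->
  (forall j, (j <= N)%N -> expbounded T sigma A (wt 0 j)) ->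
  forall j, (j <= N)%N -> expbounded T sigma (nnwr_rate hm sigma ^+ k * A) (wt k j).
Proof.
move=> s0 A0 h0; elim: k => [|k IH] j jN; first by rewrite expr0 mul1r; exact: h0.
rewrite exprS -mulrA; apply: nnwr_step => //.
by rewrite mulr_ge0// exprn_ge0// nnwr_rate_ge0.
Qed.

End contraction.

(** * Choice of the weight *)

Section chernoff.
Context {R : realType}.
Implicit Types (hm T la q : R).

Lemma expker_sqr hm T la : 0 <= hm -> 0 < T -> 0 <= la ->
  expker hm ((la * hm / T) ^+ 2) = expR (- (la * (hm ^+ 2 / T))).
Proof.
move=> h0 T0 la0; rewrite /expker sqrtr_sqr ger0_norm; last first.
  by rewrite divr_ge0 ?mulr_ge0// ltW.
by congr expR; field; rewrite gt_eqF.
Qed.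

Lemma nnwr_rateE6 hm s : 0 < hm -> 0 < s -> let E := expker hm s in
  nnwr_rate hm s = 6 * E ^+ 2 * ((2 + E) / 3 / (1 - E ^+ 2) ^+ 2).
Proof.
move=> h0 s0 /=; rewrite /nnwr_rate geomkerE.
have := expker_ge0 hm s; have := expker_lt1 h0 s0; move: (expker hm s) => y y1 y0.
by field; rewrite subr_eq0 gt_eqF// expr_lt1.
Qed.

Lemma chernoff_bound hm T k : 0 < hm -> 0 < T -> (1 <= k)%N ->
  exists2 sigma : R, 0 < sigma & nnwr_rate hm sigma ^+ k * expR (sigma * T) <=
  (Num.sqrt 6%:R / (1 - expR (- ((2 * k + 1)%:R * hm ^+ 2 / T)))) ^+ (2 * k)
     * expR (- (k%:R ^+ 2 * hm ^+ 2 / T)).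
Proof.
move=> h0 T0 k1; pose q := hm ^+ 2 / T.
have q0 : 0 < q by rewrite divr_gt0// exprn_gt0.
set y := expR _; have yE : y = expR (- ((2 * k%:R + 1) * q)).
  by rewrite /y /q natrD natrM; congr expR; ring.
have -> : expR (- (k%:R ^+ 2 * hm ^+ 2 / T)) = expR (- (k%:R ^+ 2 * q)).
  by rewrite /q mulrA.
have k0 : 1 <= k%:R :> R by rewrite ler1n.
have kk : 0 < k%:R :> R by rewrite ltr0n.
have y0 : 0 < y by exact: expR_gt0.
have y1 : y < 1 by rewrite yE expR_lt1 oppr_lt0 mulr_gt0// addr_gt0// mulr_gt0.
have rhsE : (Num.sqrt 6%:R / (1 - y)) ^+ (2 * k) = 6 ^+ k * ((1 - y) ^- 2) ^+ k.
  by rewrite exprM expr_div_n sqr_sqrtr ?ler0n// exprMn.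
rewrite rhsE.
(* With [sqrt sigma = la hm / T] one has [E = exp (- la q)] and [sigma T = la^2 q], and the factor
   [6^k] is common to both sides. The exponent [la^2 q - 2 k la q] is least at [la = k]. *)
suff [la la0 H] : exists2 la : R, 0 < la &
    ((2 + expR (- (la * q))) / 3 / (1 - expR (- (la * q)) ^+ 2) ^+ 2) ^+ k *
    expR (la ^+ 2 * q - 2 * k%:R * la * q) <= ((1 - y) ^- 2) ^+ k * expR (- (k%:R ^+ 2 * q)).
  pose sigma := (la * hm / T) ^+ 2.
  have s0 : 0 < sigma by rewrite exprn_gt0// divr_gt0// mulr_gt0.
  exists sigma => //; rewrite nnwr_rateE6// expker_sqr ?(ltW h0) ?(ltW la0)// -/q.
  move: H; set B := (2 + _) / 3 / _ => H.
  have -> : sigma * T = la ^+ 2 * q by rewrite /sigma /q; field; rewrite gt_eqF.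
  have h6 : 0 <= 6 ^+ k :> R by rewrite exprn_ge0.
  rewrite -[leRHS]mulrA; apply: le_trans (ler_wpM2l h6 H).
  rewrite le_eqVlt; apply/orP; left; apply/eqP.
  have -> : expR (la ^+ 2 * q - 2 * k%:R * la * q) =
      (expR (- (la * q)) ^+ 2) ^+ k * expR (la ^+ 2 * q).
    by rewrite -exprM -expRM_natl -expRD natrM; congr expR; ring.
  by move: {H} B => B; rewrite exprMn exprMn; ring.
(* The choice [la = k + 1/2] makes [E^2] equal to [y], so the denominators agree, but raises the
   exponent by [q / 4]. This costs [1 / z], to be paid by [(2 + E) / 3 <= z]. *)
pose z := expR (- (4^-1 * q)).
have z0 : 0 < z by exact: expR_gt0.
have [z34|z34] := lerP (3 / 4) z.
- exists (k%:R + 2^-1); first by rewrite addr_gt0.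
  set E := expR (- ((k%:R + 2^-1) * q)).
  have -> : E ^+ 2 = y.
    by rewrite -expRM_natl yE; congr expR; field.
  have -> : (k%:R + 2^-1) ^+ 2 * q - 2 * k%:R * (k%:R + 2^-1) * q =
      - (k%:R ^+ 2 * q) + 4^-1 * q by field.
  rewrite expRD exprMn -!mulrA mulrCA ler_wpM2l ?exprn_ge0 ?invr_ge0 ?sqr_ge0//.
  rewrite mulrCA -[leRHS]mulr1 ler_wpM2l ?expR_ge0//.
  have z1 : z <= 1 by rewrite expR_le1 oppr_le0 mulr_ge0 ?ltW.
  have Ez : E <= z ^+ 6.
    rewrite -expRM_natl ler_expR; have : q * 1 <= q * k%:R by rewrite ler_wpM2l// ltW.
    lra.
  have E0 : 0 <= E by exact: expR_ge0.
  have z2 : 9 / 16 <= z ^+ 2 by rewrite expr2; nra.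
  have z3 : 27 / 64 <= z ^+ 3 by rewrite exprS; nra.
  have z4 : 81 / 256 <= z ^+ 4 by rewrite exprS; nra.
  have z5 : 0 <= z ^+ 5 by rewrite exprn_ge0// ltW.
  (* As [k >= 1] gives [E <= z^6], it suffices that [3 z - 2 - z^6 >= 0]. The threshold 3/4 ensures
     [z + z^2 + z^3 + z^4 >= 2] in the factorization below. *)
  have key : 2 + E <= 3 * z.
    have : (1 - z) * (z ^+ 5 + z ^+ 4 + z ^+ 3 + z ^+ 2 + z - 2) >= 0.
      by rewrite mulr_ge0//; lra.
    have -> : (1 - z) * (z ^+ 5 + z ^+ 4 + z ^+ 3 + z ^+ 2 + z - 2) = 3 * z - 2 - z ^+ 6.
      by ring.
    lra.
  have le1 : ((2 + E) / 3) ^+ k <= (2 + E) / 3 by rewrite ler_iXnr//; lra.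
  have ez : expR (4^-1 * q) = z^-1 by rewrite /z expRN invrK.
  rewrite ez ler_pdivrMr// mul1r (le_trans le1)//; lra.
- exists k%:R => //; set E := expR (- (k%:R * q)).
  have -> : k%:R ^+ 2 * q - 2 * k%:R * k%:R * q = - (k%:R ^+ 2 * q) by ring.
  rewrite ler_wpM2r ?expR_ge0//.
  have E0 : 0 < E by exact: expR_gt0.
  have Ez : E <= z ^+ 4.
    rewrite -expRM_natl ler_expR; have : q * 1 <= q * k%:R by rewrite ler_wpM2l// ltW.
    lra.
  have z2 : z ^+ 2 <= 9 / 16 by rewrite expr2; nra.
  have z22 : 0 <= z ^+ 2 by rewrite exprn_ge0// ltW.
  have z4 : z ^+ 4 <= 81 / 256 by rewrite (exprM z 2 2) (expr2 (z ^+ 2)); nra.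
  have E2 : E ^+ 2 <= 11 / 100 by rewrite expr2; nra.
  have E20 : 0 <= E ^+ 2 by rewrite exprn_ge0// ltW.
  rewrite lerXn2r ?nnegrE ?invr_ge0 ?sqr_ge0//.
    by rewrite divr_ge0 ?sqr_ge0// divr_ge0// addr_ge0// ltW.
  (* Here [E <= 81/256], so [(2 + E) / 3 < 0.78 < 0.89^2 <= (1 - E^2)^2]: the left side is at most 1
     and the right side at least 1. *)
  apply: (@le_trans _ _ 1).
    have d0 : 0 < 1 - E ^+ 2 by lra.
    rewrite ler_pdivrMr ?exprn_gt0// mul1r.
    by move: (E ^+ 2) E2 E20 => e2 h1 h2; nra.
  by rewrite invf_ge1 ?exprn_gt0 ?subr_gt0// exprn_ile1//; lra.
Qed.

End chernoff.

(** * The estimate *)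

Section Linfty.
Context {R : realType}.
Local Open Scope classical_set_scope.
Local Notation mu := (@lebesgue_measure R).

(** The norm of exponent [+oo] is defined as an essential supremum under the condition that the
    whole space has positive measure. *)
Let muT_gt0 : (0 < mu setT)%E.
Proof.
apply: (@lt_le_trans _ _ (mu `[0, 1])).
  by rewrite lebesgue_measure_itv/= lte_fin ltr01 -EFinB subr0 lte_fin.
by apply: le_measure; rewrite ?inE.
Qed.

Lemma Linfty_normP (D : set R) (f : R -> R) (y : \bar R) :
  (Linfty_norm D f <= y)%E <-> \forall t \ae mu, (`|(f \_ D) t|%:E <= y)%E.
Proof.
rewrite /Linfty_norm unlock muT_gt0.
by split=> [/ess_supP//|h]; apply/ess_supP.
Qed.

(** The restricted function is 0 outside []0, T[], whence the condition [0 <= a]. *)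
Lemma Linfty_norm_itv_le (f : R -> R) (T a : R) : 0 <= a ->
  (Linfty_norm `]0%R, T[ f <= a%:E)%E <-> \forall t \ae mu, 0 < t < T -> `|f t| <= a.
Proof.
move=> a0; rewrite Linfty_normP; split => /ae_mono; apply => t.
  by rewrite patchE mem_setE in_itv/= lee_fin => + tT; rewrite tT.
rewrite patchE mem_setE in_itv/= lee_fin.
by case: ifP => [_ /(_ isT)|_ _]//; rewrite normr0.
Qed.

Lemma le_Linfty_norm (f : R -> R) (T : R) :
  (Linfty_norm `]0%R, T[ f <= Linfty_norm `]0%R, +oo[ f)%E.
Proof.
apply/Linfty_normP.
have /Linfty_normP := lexx (Linfty_norm `]0%R, +oo[ f).
move=> /ae_mono; apply => t; apply: le_trans.
rewrite !patchE !mem_setE !in_itv/= lee_fin andbT.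
by case: ifP => [/andP[-> _]//|_]; rewrite normr0.
Qed.

End Linfty.

Lemma h_min_le (R : realType) (N : nat) (x : nat -> R) j : (1 <= j <= N)%N ->
  h_min N x <= x j - x j.-1.
Proof.
by move=> jN; apply: ge_bigmin_seq => //; rewrite mem_index_iota ltnS.
Qed.

Lemma h_min_gt0 (R : realType) (N : nat) (x : nat -> R) : (0 < N)%N ->
  (forall i : nat, (i < N)%N -> x i < x i.+1) -> 0 < h_min N x.
Proof.
move=> N0 hx; rewrite /h_min big_nat_cond; apply: lt_bigmin.
  by rewrite subr_gt0 hx.
by case=> [|i]; rewrite ?andbT// => /andP[_ iN]; rewrite subr_gt0 hx.
Qed.

Unset Implicit Arguments.

Theorem theorem3p1 (R : realType) (N : nat) (L : R) (x : nat -> R)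
  (w : nat -> nat -> R -> R) (u psi : nat -> nat -> complex R -> R -> complex R)
  (T : R)
  (hN : (2 <= N)%N)
  (hx0 : x 0%N = 0) (hxN : x N = L)
  (hx : forall i : nat, (i < N)%N -> x i < x i.+1)
  (hT : 0 < T)
  (hw : nnwr N x (4%:R^-1) w u psi)
  (k : nat) (hk : (1 <= k)%N) :
  (max_Linfty N T (w k) <=
   ((Num.sqrt 6%:R /
       (1 - expR (- ((2 * k + 1)%:R * h_min N x ^+ 2 / T)))) ^+ (2 * k)
     * expR (- (k%:R ^+ 2 * h_min N x ^+ 2 / T)))%:E
   * max_Linfty N T (w 0%N))%E.
Proof.
have h0 : 0 < h_min N x by apply: h_min_gt0 => //; exact: ltnW.
have [sigma s0 bound] := chernoff_bound h0 hT hk.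
move: bound; set C := (X in _ <= X -> _) => bound.
have wle i : (1 <= i < N)%N ->
    (Linfty_norm `]0%R, T[%classic (w 0%N i) <= max_Linfty N T (w 0%N))%E.
  move=> iN; apply: (le_bigmax_seq 0%E i xpredT
    (fun i => Linfty_norm `]0%R, T[%classic (w 0%N i))) => //.
  by rewrite mem_index_iota.
have M0 : (0 <= max_Linfty N T (w 0%N))%E by exact: bigmax_ge_id.
(* The guesses are bounded on []0, +oo[], so the maximum is a real number and can serve as [A]. *)
have Mfin : max_Linfty N T (w 0%N) \is a fin_num.
  rewrite ge0_fin_numE// /max_Linfty big_nat_cond; apply: bigmax_lt => // i.
  rewrite andbT => iN.
  exact: le_lt_trans (le_Linfty_norm _ _) (nnwr_guess hw iN).
pose A := fine (max_Linfty N T (w 0%N)).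
have A0 : 0 <= A by exact: fine_ge0.
have ME : max_Linfty N T (w 0%N) = A%:E by rewrite /A fineK.
have w0A j : (j <= N)%N -> expbounded T sigma A (causal_part (w 0%N j)).
  move=> jN; have [j0N|] := boolP ((j == 0%N) || (j == N)).
    apply: nearW => t _; rewrite /causal_part patchE; have [w0 wN] := nnwr_outer hw 0%N t.
    have -> : w 0%N j t = 0 by case/orP: j0N => /eqP ->.
    by rewrite if_same normr0 mulr_ge0 ?expR_ge0.
  rewrite negb_or -lt0n => /andP[j0 jN'].
  have jlt : (1 <= j < N)%N by rewrite j0 ltn_neqAle jN'.
  (* For [t > 0] the weight [exp (sigma t)] is at least 1, so the plain bound is a weighted one. *)
  have := wle j jlt; rewrite ME Linfty_norm_itv_le// => /ae_mono; apply=> t h tT.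
  rewrite /causal_part patchE mem_setE in_itv/= andbT (andP tT).1.
  rewrite (le_trans (h tT))// ler_peMr// -expR0 ler_expR mulr_ge0 ?(ltW s0)//.
  by rewrite ltW// (andP tT).1.
have hmE j : (1 <= j <= N)%N -> h_min N x <= x j - x j.-1 by exact: h_min_le.
have cont := nnwr_contraction hN hx hw h0 hmE k s0 A0 w0A.
have C0 : 0 <= C.
  apply: le_trans bound; rewrite mulr_ge0 ?expR_ge0// exprn_ge0//.
  exact: nnwr_rate_ge0.
rewrite ME -EFinM /max_Linfty big_nat_cond; apply: bigmax_le.
  by rewrite lee_fin mulr_ge0.
move=> i; rewrite andbT => /andP[_ /ltnW iN].
apply/Linfty_norm_itv_le; first by rewrite mulr_ge0.
apply: (ae_mono (cont i iN)) => t h tT; have := h tT.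
rewrite /causal_part patchE mem_setE in_itv/= andbT (andP tT).1 => /le_trans; apply.
(* Leaving the weighted norm costs at most [exp (sigma T)], the factor included in
   [chernoff_bound]. *)
rewrite mulrAC ler_wpM2r//; apply: le_trans bound.
rewrite ler_wpM2l ?exprn_ge0 ?nnwr_rate_ge0//.
by rewrite ler_expR ler_wpM2l ?(ltW s0)// ltW// (andP tT).2.
Qed.
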